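(* Let $\mathbb{F}_q$ be a finite field and let $a\in M_n(\mathbb{F}_q)$ have a unique eigenvalue $\alpha$. Then $$|K_n(a)|\le|K_n(\alpha I)|\le 4q^{(3n^2-\delta(n))/4},$$ where $\delta(n)=0$ if $n$ is even and $\delta(n)=1$ if $n$ is odd.
   Context: $\mathbb{F}_q$ is a finite field of characteristic $p$. The additive character $\varphi:\mathbb{F}_q\to\mathbb{C}^*$ is $\varphi(x)=\exp(2\pi i\,\mathrm{Tr}_{\mathbb{F}_q/\mathbb{F}_p}(x)/p)$, and $\psi=\varphi\circ\mathrm{tr}$ on $M_n(\mathbb{F}_q)$, where $\mathrm{tr}$ is the matrix trace. For $a\in M_n(\mathbb{F}_q)$, $K_n(a)=\sum_{x\in \mathrm{GL}_n(\mathbb{F}_q)}\psi(ax+x^{-1})$. $I$ is the $n\times n$ identity matrix. A unique eigenvalue $\alpha$ (over an algebraic closure) means that the characteristic polynomial is $(t-\alpha)^n$; then $\alpha\in\mathbb{F}_q$. *)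

(* Defs.v *)
From HB Require Import structures.
From mathcomp Require Import all_boot all_order all_fingroup all_algebra all_field.
From mathcomp Require Import reals exp trigo.
From mathcomp Require Import complex.

Set Implicit Arguments.
Unset Strict Implicit.
Unset Printing Implicit Defensive.

Import GRing.Theory.

Local Open Scope ring_scope.
Local Open Scope complex_scope.

Section KloostermanSum.
Variables (R : realType) (p : nat) (F : finFieldType).
Variable charF : p \in [pchar F].

(* galTrace has its values in F itself; they lie in the prime subfield, and
   the absolute trace is the coordinate on the basis 1 (see absTraceE). *)
Definition absTrace (x : F) : 'F_p :=
  let L := pPrimeCharType charF in
  coord [tuple 1%R : L] ord0 (galTrace 1%AS {: L} (x : L)).

Lemma absTraceE (x : F) :
  (absTrace x)%:R = galTrace 1%AS {: pPrimeCharType charF} x :> F.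
Proof.
set L := pPrimeCharType charF; set y := galTrace _ _ _.
have y1 : y \in <<[tuple 1%R : L]>>%VS.
  rewrite span_seq1; apply: mem_galTrace; last exact: memvf.
  exact: finField_galois (sub1v _).
transitivity ((absTrace x) *: (1%R : L)); first by rewrite -[LHS]mulr1.
by rewrite [RHS](coord_span y1) big_ord1.
Qed.

(* The representative of the trace in {0, .., p - 1} is used in the exponent;
   expi t = exp (i t). *)
Definition expi (t : R) : R[i] := cos t +i* sin t.

Definition addChar (x : F) : R[i] :=
  expi (2 * pi * (absTrace x : nat)%:R / p%:R).

Definition mxChar n (x : 'M[F]_n) : R[i] := addChar (\tr x).

Definition Kloosterman n (a : 'M[F]_n) : R[i] :=
  \sum_(x : 'M[F]_n | x \in unitmx) mxChar (a *m x + invmx x).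

End KloostermanSum.

(* Main.v *)
Require Import Defs.
From HB Require Import structures.
From mathcomp Require Import all_boot all_order all_fingroup all_algebra all_field.
From mathcomp Require Import reals exp trigo.
From mathcomp Require Import complex.
From mathcomp Require Import zify ring lra.

Set Implicit Arguments.
Unset Strict Implicit.
Unset Printing Implicit Defensive.

Import Order.TTheory GRing.Theory Num.Theory.

Local Open Scope ring_scope.

(** Write K_n(a) for the matrix sum, K_1 for the one-variable sum of
    phi (alpha s + 1 / s) over s <> 0, and q for the order of F.

    _Reduction to one variable._ Choose a basis whose first vector e1 is an
    eigenvector of a, and split the sum over x according to the vector w = x e1.
    The x that fix the line of e1 are block upper triangular and contribute
    q^(n-1) K_1 K_(n-1)(a'), where a' is induced by a on the quotient by that
    line ([sum_line]).  If w is off the line, a change of basis fixing e1 makes w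
    the second basis vector.  Averaging over the transvections x -> (1 + z) x
    that fix both e1 and w kills all x but those that preserve the plane spanned
    by e1 and w ([transvection_averaging], [moves_drift0]).  What remains is an
    explicit sum over 2 x 2 matrices times K_(n-2)(a''): it has absolute value
    q^(2n-3) |K_(n-2)(a'')| if alpha <> 0 and a preserves the plane, and vanishes
    otherwise ([sum_moves]).  For scalar a every one of the q^n - q vectors w
    contributes q^(2n-3) K_(n-2) (or 0, if alpha = 0), so that K_n(alpha I)
    satisfies an exact two-step recursion ([matrix_kloosterman_scalar]); for
    general a the triangle inequality bounds |K_n(a)| by the solution of the same
    recursion with |K_1| in the place of K_1 ([matrix_kloosterman_le]).  Since
    K_1 is real and the coefficients are nonnegative, that solution is
    |K_n(alpha I)| ([norm_matrix_kloosterman_scalar]), which is the first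
    inequality.

    _Weil's bound for K_1._ Assume alpha <> 0.  Attach to a monic polynomial g
    with g(0) <> 0 the value phi (sum over the roots y of g of alpha y + 1 / y),
    a multiplicative function of g.  Its sums over the g of degree 0, 1, 2, 3, ...
    are 1, K_1, q, 0, 0, ... ([Lcoef0], [Lcoef1], [Lcoef2], [Lcoef_eq0]).  Unique
    factorization turns this into Newton identities for the Kloosterman sums K^(r)
    over the extensions of degree r of F ([newton_identity], [power_sum_fibers]):
    K^(r) = - (b1^r + b2^r) with b1 + b2 = - K_1 and b1 b2 = q.  Stepanov's method
    ([stepanov_bound]) bounds the number of x in the extension of degree 2j at
    which alpha x + 1 / x has a given trace in F, from which K^(2j) is at most a
    constant times q^j ([power_sum_even_bound]).  If K_1^2 > 4 q then b1 and b2
    are real and letting j grow gives b1^2, b2^2 <= q, whence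
    K_1^2 = b1^2 + b2^2 + 2 q <= 4 q after all ([weil_bound]).

    _Solving the recursion._ Divide the terms of even index 2j by q^(3 j^2), those
    of odd index 2j + 1 by q^(3 j^2 + 3 j + 1/2), and put kappa = |K_1| / sqrt q.
    The quotients then grow by at most a geometric series of ratio 1 / q, and stay
    below 1 + 4 kappa / (q - 1) and kappa (1 + (1 + 4 kappa / (q - 1)) / (q - 1)).
    Both are at most 4 because kappa <= 2 and, for small q, because trivially
    |K_1| <= q - 1 ([scalar_recursion_parity]). *)

(** * Additive characters *)

Section AdditiveCharacter.
Variables (F : finFieldType) (C : fieldType) (phi : F -> C).

Definition nontrivial_character :=
  [/\ phi 0 = 1, {morph phi : x y / x + y >-> x * y} & exists t, phi t != 1].

Hypothesis phiP : nontrivial_character.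

Lemma sum_character : \sum_x phi x = 0.
Proof.
have [_ phiD [t ne1]] := phiP.
apply/eqP; have : (1 - phi t) * \sum_x phi x == 0.
  rewrite mulrBl mul1r subr_eq0 mulr_sumr.
  rewrite [X in X == _](reindex_inj (addrI t)) /=.
  by apply/eqP/eq_bigr => x _; rewrite phiD.
by rewrite mulf_eq0 subr_eq0 eq_sym (negPf ne1).
Qed.

Lemma sum_character_scale c :
  \sum_x phi (c * x) = if c == 0 then #|F|%:R else 0.
Proof.
have [phi0 _ _] := phiP; case: eqVneq => [->|nz_c].
  by under eq_bigr do rewrite mul0r phi0; rewrite sumr_const.
by rewrite -[RHS]sum_character [RHS](reindex_inj (mulfI nz_c)).
Qed.

End AdditiveCharacter.

Definition kloosterman_sum (F : finFieldType) (C : fieldType) (phi : F -> C) (a : F) :=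
  \sum_(x | x != 0) phi (a * x + x^-1).

(** * Matrix sums restricted to block upper triangular matrices *)
Section UpperBlocks.
Variable F : comUnitRingType.

Lemma unitmx_ublock m1 m2 (x1 : 'M[F]_m1) y (x2 : 'M[F]_m2) :
  (block_mx x1 y 0 x2 \in unitmx) = (x1 \in unitmx) && (x2 \in unitmx).
Proof. by rewrite !unitmxE det_ublock unitrM. Qed.

Lemma invmx_ublock m1 m2 (x1 : 'M[F]_m1) y (x2 : 'M[F]_m2) :
  x1 \in unitmx -> x2 \in unitmx ->
  invmx (block_mx x1 y 0 x2)
    = block_mx (invmx x1) (- (invmx x1 *m y *m invmx x2)) 0 (invmx x2).
Proof.
move=> U1 U2; have Ux : block_mx x1 y 0 x2 \in unitmx by rewrite unitmx_ublock U1.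
rewrite -[LHS]mulmx1; apply: (canLR (mulKmx Ux)).
rewrite mulmx_block !mulmx0 !mul0mx !addr0 add0r !mulmxV // mulmxN !mulmxA.
by rewrite mulmxV // mul1mx addNr -scalar_mx_block.
Qed.

End UpperBlocks.

Section MatrixSums.
Variables (F : finFieldType) (C : fieldType) (phi : F -> C).
Hypothesis phiP : nontrivial_character phi.
Local Notation q := #|F|.

Definition kloosterman_phase n (a x : 'M[F]_n) : C := phi (\tr (a *m x + invmx x)).

Definition matrix_kloosterman n (a : 'M[F]_n) : C :=
  \sum_(x : 'M[F]_n | x \in unitmx) kloosterman_phase a x.

(** The pairing (b, y) -> tr (b y) is nondegenerate, so a nonzero b makes
    y -> phi (tr (b y)) a nontrivial character of the additive group of matrices. *)
Lemma sum_mx_character m n (b : 'M[F]_(n, m)) :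
  \sum_(y : 'M[F]_(m, n)) phi (\tr (b *m y)) = if b == 0 then (q ^ (m * n))%:R else 0.
Proof.
have [phi0 phiD [t ne1]] := phiP; case: eqVneq => [->|nz_b].
  under eq_bigr do rewrite mul0mx mxtrace0 phi0.
  by rewrite sumr_const; congr _%:R; rewrite -card_mx; apply: eq_card.
have /matrix0Pn[i [j nz_bij]] := nz_b.
pose y0 := (t / b i j) *: delta_mx j i : 'M[F]_(m, n).
have try0 : \tr (b *m y0) = t.
  rewrite -scalemxAr mxtraceZ mxtrace_mulC /mxtrace (bigD1 j) //= big1 => [|k ne_k].
    rewrite addr0 mxE (bigD1 i) //= big1 => [|k ne_k].
      by rewrite mxE !eqxx mul1r addr0 divfK.
    by rewrite mxE eqxx (negPf ne_k) mul0r.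
  by rewrite mxE big1 // => l _; rewrite mxE (negPf ne_k) mul0r.
apply/eqP; set S := \sum_y _; have : (1 - phi t) * S == 0.
  rewrite mulrBl mul1r subr_eq0 mulr_sumr /S.
  rewrite [X in X == _](reindex_inj (addrI y0)) /=; apply/eqP.
  by apply: eq_bigr => y _; rewrite mulmxDr mxtraceD try0 phiD.
by rewrite mulf_eq0 subr_eq0 eq_sym (negPf ne1).
Qed.

(** The corner y of x = [x1 y; 0 x2] enters the phase only through the trace of
    a21 y, because the diagonal blocks of the inverse of x do not involve y.
    Summing over y therefore forces a21 = 0 and separates x1 from x2. *)
Lemma sum_block_upper m1 m2 (a : 'M[F]_(m1 + m2)) (P : pred 'M[F]_m1) :
  \sum_(x : 'M[F]_(m1 + m2) | [&& x \in unitmx, dlsubmx x == 0 & P (ulsubmx x)])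
     kloosterman_phase a x =
  if dlsubmx a == 0 then (q ^ (m1 * m2))%:R *
    (\sum_(x1 | (x1 \in unitmx) && P x1) kloosterman_phase (ulsubmx a) x1)
    * matrix_kloosterman (drsubmx a)
  else 0.
Proof.
have [_ phiD _] := phiP.
pose h (t : 'M[F]_m1 * 'M[F]_m2 * 'M[F]_(m1, m2)) : 'M[F]_(m1 + m2) :=
  block_mx t.1.1 t.2 0 t.1.2.
pose h' (x : 'M[F]_(m1 + m2)) := (ulsubmx x, drsubmx x, ursubmx x).
rewrite (reindex_onto h h') /=; last first.
  by move=> x /and3P[_ /eqP x0 _]; rewrite /h /h' /= -{4}[x]submxK x0.
pose P1 (u : 'M[F]_m1 * 'M[F]_m2) := [&& u.1 \in unitmx, P u.1 & u.2 \in unitmx].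
transitivity (\sum_(u | P1 u) \sum_(y : 'M[F]_(m1, m2))
   kloosterman_phase (ulsubmx a) u.1 * kloosterman_phase (drsubmx a) u.2
    * phi (\tr (dlsubmx a *m y))).
  rewrite pair_big_dep /=; apply: eq_big => [[[x1 x2] y]|[[x1 x2] y]].
    rewrite /h /h' /P1 /= block_mxKul block_mxKdl block_mxKdr block_mxKur !eqxx.
    by rewrite unitmx_ublock !andbT /=; case: (_ \in _); case: (_ \in _); case: (P _).
  rewrite /h /= block_mxKul block_mxKdl unitmx_ublock.
  case/andP=> /andP[/andP[U1 U2] _] _; rewrite /kloosterman_phase invmx_ublock //.
  rewrite -{1}[a]submxK mulmx_block add_block_mx mxtrace_block -!phiD; congr phi.
  by rewrite !mulmx0 !addr0 !mxtraceD; ring.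
transitivity (\sum_(u | P1 u)
   kloosterman_phase (ulsubmx a) u.1 * kloosterman_phase (drsubmx a) u.2
    * (if dlsubmx a == 0 then (q ^ (m1 * m2))%:R else 0)).
  by apply: eq_bigr => u _; rewrite -mulr_sumr sum_mx_character.
case: ifP => _; last by rewrite big1 // => u _; rewrite mulr0.
rewrite -mulr_suml mulrC -mulrA; congr (_ * _).
transitivity (\sum_(x1 | (x1 \in unitmx) && P x1) \sum_(x2 : 'M[F]_m2 | x2 \in unitmx)
   kloosterman_phase (ulsubmx a) x1 * kloosterman_phase (drsubmx a) x2).
  by rewrite pair_big_dep /=; apply: eq_bigl => u; rewrite /P1 andbA.
by rewrite mulr_suml; apply: eq_bigr => x1 _; rewrite -mulr_sumr.
Qed.

Lemma kloosterman_phase_conj n (g a x : 'M[F]_n) : g \in unitmx -> x \in unitmx ->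
  kloosterman_phase a (g *m x *m invmx g) = kloosterman_phase (invmx g *m a *m g) x.
Proof.
move=> Ug Ux; rewrite /kloosterman_phase; congr phi.
have -> : invmx (g *m x *m invmx g) = g *m invmx x *m invmx g.
  have Ugx : g *m x *m invmx g \in unitmx by rewrite !unitmx_mul unitmx_inv Ug Ux.
  rewrite -[LHS]mulmx1; apply: (canLR (mulKmx Ugx)).
  by rewrite !mulmxA mulmxKV // -(mulmxA g) mulmxV // mulmx1 mulmxV.
rewrite !mxtraceD; congr (_ + _); last by rewrite mxtrace_mulC mulmxA mulVmx // mul1mx.
by rewrite mulmxA mxtrace_mulC !mulmxA.
Qed.

Lemma sum_conj n (g a : 'M[F]_n) (P : pred 'M[F]_n) : g \in unitmx ->
  \sum_(x | (x \in unitmx) && P x) kloosterman_phase a x =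
  \sum_(x | (x \in unitmx) && P (g *m x *m invmx g))
    kloosterman_phase (invmx g *m a *m g) x.
Proof.
move=> Ug; rewrite (reindex (fun x => g *m x *m invmx g)) /=; last first.
  exists (fun x => invmx g *m x *m g) => x _.
    by rewrite !mulmxA mulVmx // mul1mx mulmxKV.
  by rewrite !mulmxA mulmxV // mul1mx mulmxK.
apply: eq_big => [x|x /andP[]]; first by rewrite !unitmx_mul unitmx_inv Ug andbT.
by rewrite !unitmx_mul unitmx_inv Ug andbT => Ux _; rewrite kloosterman_phase_conj.
Qed.

Lemma matrix_kloosterman_conj n (g a : 'M[F]_n) : g \in unitmx ->
  matrix_kloosterman (invmx g *m a *m g) = matrix_kloosterman a.
Proof.
move=> Ug; rewrite /matrix_kloosterman.
under eq_bigl do rewrite -[_ \in _]andbT; rewrite -(sum_conj a xpredT Ug).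
by apply: eq_bigl => x; rewrite andbT.
Qed.

Lemma matrix_kloosterman0 (a : 'M[F]_0) : matrix_kloosterman a = 1.
Proof.
have [phi0 _ _] := phiP; rewrite /matrix_kloosterman (big_pred1 0) => [|x].
  by rewrite /kloosterman_phase /mxtrace big_ord0.
by rewrite [x]flatmx0 /= eqxx unitmxE det_mx00 unitr1.
Qed.

Lemma matrix_kloosterman1 (a : 'M[F]_1) :
  matrix_kloosterman a = kloosterman_sum phi (a 0 0).
Proof.
rewrite /matrix_kloosterman (reindex (fun s : F => s%:M)) /=; last first.
  exists (fun x : 'M[F]_1 => x 0 0) => x _; first by rewrite mxE eqxx.
  by rewrite -mx11_scalar.
rewrite /kloosterman_sum; apply: eq_big => [s|s].
  by rewrite unitmxE det_scalar1 unitfE.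
rewrite unitmxE det_scalar1 unitfE => nz_s; rewrite /kloosterman_phase invmx_scalar.
by congr phi; rewrite mxtraceD mul_mx_scalar mxtraceZ mxtrace_scalar /mxtrace big_ord1 mulrC.
Qed.
End MatrixSums.

(** * Matrices sending the first basis vector to the second one *)
Section PlaneSums.
Variables (F : finFieldType) (C : numFieldType) (phi : F -> C).
Hypothesis phiP : nontrivial_character phi.
Local Notation q := #|F|.
Let f0 : 'cV[F]_2 := delta_mx 0 0.
Let f1 : 'cV[F]_2 := delta_mx 1 0.

Lemma col2_sum (v : 'cV[F]_2) : v = v 0 0 *: f0 + v 1 0 *: f1.
Proof.
apply/colP => i; rewrite !mxE eqxx !andbT.
by case: i => [[|[|]]] //= Hi; rewrite ?mulr1 ?mulr0 ?addr0 ?add0r;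
  congr (v _ _); apply: val_inj.
Qed.

(** The matrices in the sum are X = [0 s; 1 t] with s <> 0, and for an upper
    triangular A with diagonal al, d and corner b the phase at X is
    b + (d - 1 / s) t.  The sum over t selects s = 1 / d. *)
Lemma sum_companion2 (A : 'M[F]_2) (al : F) : A *m f0 = al *: f0 ->
  \sum_(x | (x \in unitmx) && (x *m f0 == f1)) kloosterman_phase phi A x =
  if A 1 1 == 0 then 0 else q%:R * phi (A 0 1).
Proof.
move=> A_f0; have [_ phiD _] := phiP.
have A10 : A 1 0 = 0.
  have /colP/(_ 1) := A_f0; rewrite !mxE !big_ord_recl big_ord0 !mxE /= !mulr0 !addr0 mulr1.
  by move=> <-; congr (A _ _); apply: val_inj.
pose X (u : F * F) : 'M[F]_(1 + 1) := block_mx 0 u.1%:M 1%:M u.2%:M.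
pose Y (u : F * F) : 'M[F]_(1 + 1) := block_mx (- (u.2 / u.1))%:M 1%:M (u.1^-1)%:M 0.
have XY u : u.1 != 0 -> X u *m Y u = 1%:M.
  move=> nz_u; rewrite mulmx_block !mul0mx !mulmx0 !mul1mx !add0r !addr0.
  rewrite -!scalar_mxM mulfV // -raddfD /= mulrC addrC subrr raddf0.
  by rewrite -scalar_mx_block.
have f0E : f0 = col_mx (1%:M : 'M_1) (0 : 'M_1).
  by apply/colP => -[[|[|]]] // Hi; rewrite [RHS]mxE; case: splitP => //= k Hk;
    rewrite !mxE ?(ord1 k) //=; move: (Hk); rewrite ?(ord1 k).
have f1E : f1 = col_mx (0 : 'M_1) (1%:M : 'M_1).
  by apply/colP => -[[|[|]]] // Hi; rewrite [RHS]mxE; case: splitP => //= k Hk;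
    rewrite !mxE ?(ord1 k) //=; move: (Hk); rewrite ?(ord1 k).
have XuE u : X u *m f0 = f1.
  by rewrite f0E f1E mul_block_col !mulmx0 mul0mx mul1mx !addr0.
have Xunit u : (X u \in unitmx) = (u.1 != 0).
  apply/idP/idP => [Ux|nz_u]; last by have /mulmx1_unit[] := XY u nz_u.
  apply: contraTneq Ux => u0; rewrite unitmxE unitfE negbK.
  rewrite /X u0 raddf0 -[block_mx _ _ _ _]trmxK det_tr tr_block_mx.
  by rewrite !trmx0 det_ublock det0 mul0r.
have Xinv u : u.1 != 0 -> invmx (X u) = Y u.
  move=> nz_u; rewrite -[LHS]mulmx1; apply: (canLR (mulKmx _)); rewrite ?Xunit //.
  by rewrite XY.
pose h (x : 'M[F]_(1 + 1)) := (ursubmx x 0 0, drsubmx x 0 0).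
have hX u : h (X u) = u.
  by rewrite /h /X block_mxKur block_mxKdr !mxE !eqxx; case: u.
rewrite (reindex_onto X h) => [|x /andP[_]]; last first.
  have xf0 (y : 'M[F]_(1 + 1)) :
      y *m (col_mx 1%:M 0 : 'cV_(1 + 1)) = col_mx (ulsubmx y) (dlsubmx y).
    by rewrite -{1}[y]submxK mul_block_col !mulmx0 !mulmx1 !addr0.
  rewrite f0E f1E [X in X == _]xf0 => /eqP col_x.
  have ul0 := congr1 (@usubmx F 1 1 1) col_x.
  have dl1 := congr1 (@dsubmx F 1 1 1) col_x.
  rewrite !col_mxKu in ul0; rewrite !col_mxKd in dl1.
  by rewrite /X -!mx11_scalar -{3}[x]submxK ul0 dl1.
pose B : 'M[F]_(1 + 1) := A.
have trBX u : \tr (B *m X u) = A 0 1 + A 1 1 * u.2.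
  rewrite -{1}[B]submxK mulmx_block mxtrace_block.
  rewrite !mulmx0 !mulmx1 !add0r !mul_mx_scalar !mxtraceD !mxtraceZ.
  have -> : \tr (ursubmx B) = A 0 1.
    by rewrite /mxtrace big_ord1 !mxE; congr (A _ _); apply: val_inj.
  have -> : \tr (drsubmx B) = A 1 1.
    by rewrite /mxtrace big_ord1 !mxE; congr (A _ _); apply: val_inj.
  have -> : \tr (dlsubmx B) = 0.
    by rewrite /mxtrace big_ord1 !mxE -A10; congr (A _ _); apply: val_inj.
  by ring.
have trY u : \tr (Y u) = - (u.2 / u.1).
  by rewrite mxtrace_block !mxtrace_scalar mxtrace0 addr0 mulr1n.
have phaseE u : u.1 != 0 ->
  kloosterman_phase phi A (X u) = phi (A 0 1) * phi ((A 1 1 - u.1^-1) * u.2).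
  move=> nz_u; rewrite /kloosterman_phase Xinv // -phiD; congr phi.
  by rewrite mxtraceD [X in X + _]trBX [X in _ + X]trY; ring.
transitivity (\sum_(s | s != 0) \sum_t phi (A 0 1) * phi ((A 1 1 - s^-1) * t)).
  rewrite pair_big_dep /=; apply: eq_big => [u|u /andP[/andP[]]].
    by rewrite Xunit XuE hX !eqxx !andbT.
  by rewrite Xunit => nz_u _ _; rewrite phaseE.
have -> : \sum_(s | s != 0) \sum_t phi (A 0 1) * phi ((A 1 1 - s^-1) * t)
    = \sum_(s | s != 0) phi (A 0 1) * (if A 1 1 - s^-1 == 0 then q%:R else 0).
  by apply: eq_bigr => s _; rewrite -mulr_sumr sum_character_scale.
have [A11|nz_A] := eqVneq (A 1 1) 0.
  rewrite big1 // => s nz_s; rewrite A11 sub0r oppr_eq0 invr_eq0 (negPf nz_s).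
  by rewrite mulr0.
rewrite (bigD1 (A 1 1)^-1) ?invr_eq0 //= invrK subrr eqxx mulrC big1 ?addr0 //.
move=> s /andP[nz_s ne_s]; rewrite ifN ?mulr0 // subr_eq0.
by apply: contra ne_s => /eqP->; rewrite invrK.
Qed.

Lemma sum_mx_row_character m (b : 'cV[F]_m) :
  \sum_(y : 'rV[F]_m) phi (\tr (b *m y)) = if b == 0 then (q ^ m)%:R else 0.
Proof. by rewrite sum_mx_character // mul1n. Qed.

Variables (m : nat) (a : 'M[F]_(2 + m)) (al : F).
Let e1 : 'cV[F]_(2 + m) := col_mx f0 0.
Let e2 : 'cV[F]_(2 + m) := col_mx f1 0.
Hypothesis a_e1 : a *m e1 = al *: e1.

(** The drift is the obstruction to x preserving the plane of e1 and e2: if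
    x e1 = e2 then x a e1 is in the plane, and the drift is minus the component
    of x^-1 e1 that is transversal to the plane. *)
Let moves (x : 'M[F]_(2 + m)) := (x \in unitmx) && (x *m e1 == e2).
Let drift (x : 'M[F]_(2 + m)) := dlsubmx (x *m a - invmx x) *m f0.

(** For z = e1 eta with a row eta that vanishes on e1 and e2, one has z z = 0, and
    x -> (1 + z) x permutes the x with x e1 = e2.  It adds eta applied to the
    drift of x to the argument of phi, so averaging over eta leaves the x without
    drift. *)
Lemma transvection_averaging :
  \sum_(x | moves x) kloosterman_phase phi a x =
  \sum_(x | moves x && (drift x == 0)) kloosterman_phase phi a x.
Proof.
have [_ phiD _] := phiP.
have q_gt0 : (0 < q)%N := ltnW (finNzRing_gt1 F).
have nz_qm : (q ^ m)%:R != 0 :> C by rewrite pnatr_eq0 -lt0n expn_gt0 q_gt0.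
pose z (y : 'rV[F]_m) : 'M[F]_(2 + m) := block_mx 0 (f0 *m y) 0 0.
have zz y : z y *m z y = 0.
  by rewrite /z mulmx_block !mul0mx !mulmx0 !addr0 block_mx0.
have ze y (v : 'cV_2) : z y *m col_mx v 0 = 0.
  by rewrite mul_block_col !mul0mx !mulmx0 !addr0 col_mx0.
have uK y : (1%:M - z y) *m (1%:M + z y) = 1%:M.
  by rewrite mulmxDr mulmx1 mulmxBl mul1mx zz subr0 subrK.
have uK' y : (1%:M + z y) *m (1%:M - z y) = 1%:M.
  by rewrite mulmxBr mulmx1 mulmxDl mul1mx zz addr0 addrK.
have Uu y : 1%:M + z y \in unitmx by have /mulmx1_unit[] := uK' y.
have uV y : invmx (1%:M + z y) = 1%:M - z y.
  by rewrite -[LHS]mulmx1; apply: (canLR (mulKmx (Uu y))).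
have inv_mul (g x : 'M[F]_(2 + m)) : g \in unitmx -> x \in unitmx ->
    invmx (g *m x) = invmx x *m invmx g.
  move=> Ug Ux; have Ugx : g *m x \in unitmx by rewrite unitmx_mul Ug.
  rewrite -[LHS]mulmx1; apply: (canLR (mulKmx Ugx)).
  by rewrite mulmxA mulmxK // mulmxV.
have shift y : \sum_(x | moves x) kloosterman_phase phi a x =
   \sum_(x | moves x) kloosterman_phase phi a x * phi (\tr (drift x *m y)).
  rewrite (reindex (fun x => (1%:M + z y) *m x)) /=; last first.
    exists (fun x => (1%:M - z y) *m x) => x _; first by rewrite mulmxA uK mul1mx.
    by rewrite mulmxA uK' mul1mx.
  have ue2 : (1%:M + z y) *m e2 = e2 by rewrite mulmxDl mul1mx ze addr0.
  apply: eq_big => [x|x /andP[]].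
    rewrite /moves unitmx_mul Uu /=; congr (_ && _).
    by rewrite -mulmxA -{1}ue2 (inj_eq (can_inj (mulKmx (Uu y)))).
  rewrite unitmx_mul Uu /= => Ux _; rewrite /kloosterman_phase inv_mul // uV -phiD.
  congr phi; rewrite mulmxDl mul1mx mulmxDr mulmxBr mulmx1 !mxtraceD raddfN /=.
  have -> : \tr (drift x *m y) = \tr (z y *m (x *m a - invmx x)).
    rewrite -[in RHS](submxK (x *m a - invmx x)) /z mulmx_block mxtrace_block.
    by rewrite !mul0mx !add0r mxtrace0 addr0 /drift -mulmxA mxtrace_mulC.
  rewrite mulmxBr mxtraceD raddfN /= [\tr (z y *m invmx x)]mxtrace_mulC.
  by rewrite [\tr (a *m (z y *m x))]mxtrace_mulC -mulmxA; ring.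
apply: (mulfI nz_qm).
transitivity (\sum_(y : 'rV[F]_m) \sum_(x | moves x)
   kloosterman_phase phi a x * phi (\tr (drift x *m y))).
  transitivity (\sum_(y : 'rV[F]_m) \sum_(x | moves x) kloosterman_phase phi a x).
    by rewrite sumr_const (eq_card (_ : _ =1 predT)) // card_mx mul1n mulr_natl.
  by apply: eq_bigr => y _; apply: shift.
rewrite exchange_big [in RHS]big_mkcondr mulr_sumr; apply: eq_bigr => x _.
rewrite -mulr_sumr sum_mx_row_character /drift.
by case: ifP => _; rewrite ?mulr0 // mulrC.
Qed.

Let mul_e1 (x : 'M[F]_(2 + m)) :
  x *m e1 = col_mx (ulsubmx x *m f0) (dlsubmx x *m f0).
Proof. by rewrite -{1}[x]submxK mul_block_col !mulmx0 !addr0. Qed.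

Lemma driftE x : drift x = al *: dsubmx (x *m e1) - dsubmx (invmx x *m e1).
Proof.
have -> : drift x = dsubmx ((x *m a - invmx x) *m e1) by rewrite mul_e1 col_mxKd.
by rewrite mulmxBl -mulmxA a_e1 -scalemxAr linearB linearZ.
Qed.

(** Without drift, x^-1 e1 = c0 e1 + c1 e2.  Here c1 <> 0 since x e1 = e2 is not
    proportional to e1; applying x shows that x e2 is in the plane of e1, e2. *)
Lemma moves_drift0 x : moves x && (drift x == 0) =
  [&& x \in unitmx, dlsubmx x == 0 & ulsubmx x *m f0 == f1].
Proof.
rewrite /moves driftE -andbA; case Ux: (x \in unitmx) => //=.
pose v := invmx x *m e1; rewrite -/v.
have xv : x *m v = e1 by rewrite mulKVmx.
apply/andP/andP => [[/eqP x_e1]|[/eqP dl0 /eqP ul_f0]]; last first.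
  have x_e1 : x *m e1 = e2 by rewrite mul_e1 dl0 ul_f0 mul0mx.
  rewrite x_e1 eqxx col_mxKd scaler0 sub0r oppr_eq0 /v; split=> //.
  rewrite mul_e1 col_mxKd; move: Ux; rewrite -[x]submxK dl0 unitmx_ublock.
  by case/andP=> U1 U2; rewrite invmx_ublock // block_mxKdl mul0mx.
rewrite x_e1 col_mxKd scaler0 sub0r oppr_eq0 => /eqP v_low.
have vE : v = col_mx (usubmx v) 0 by rewrite -{1}[v]vsubmxK v_low.
have := x_e1; rewrite mul_e1 => eq_e2.
have ul_f0 : ulsubmx x *m f0 = f1.
  by have := congr1 (@usubmx F 2 m 1) eq_e2; rewrite !col_mxKu.
have dl_f0 : dlsubmx x *m f0 = 0.
  by have := congr1 (@dsubmx F 2 m 1) eq_e2; rewrite !col_mxKd.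
rewrite ul_f0 eqxx; split=> //.
have uvE := col2_sum (usubmx v); set c0 := _ 0 0 in uvE; set c1 := _ 1 0 in uvE.
have nz_c1 : c1 != 0.
  apply/eqP => c1_0; have : c0 *: e2 = e1.
    rewrite -x_e1 scalemxAr -[RHS]xv; congr (_ *m _).
    by rewrite vE uvE c1_0 scale0r addr0 /e1 scale_col_mx scaler0.
  move/(congr1 (@usubmx F 2 m 1)); rewrite linearZ /= !col_mxKu.
  by move=> /colP/(_ 0)/eqP; rewrite !mxE /= mulr0 eq_sym oner_eq0.
have dl_f1 : dlsubmx x *m f1 = 0.
  have dl_v : dlsubmx x *m usubmx v = 0.
    have : dsubmx (x *m v) = 0 by rewrite xv col_mxKd.
    by rewrite vE -{1}[x]submxK mul_block_col col_mxKd mulmx0 addr0 col_mxKu.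
  move: dl_v; rewrite uvE mulmxDr -!scalemxAr dl_f0 scaler0 add0r => /eqP.
  by rewrite scaler_eq0 (negPf nz_c1) => /eqP.
apply/eqP/matrixP => i j; rewrite [RHS]mxE.
have : dlsubmx x *m (delta_mx j 0 : 'cV[F]_2) = 0.
  by rewrite [X in _ *m X]col2_sum mulmxDr -!scalemxAr dl_f0 dl_f1 !scaler0 addr0.
by move=> /colP/(_ i); rewrite -colE !mxE.
Qed.

Lemma sum_moves :
  \sum_(x | (x \in unitmx) && (x *m e1 == e2)) kloosterman_phase phi a x =
  if dlsubmx a == 0 then
    (q ^ (2 * m))%:R * (if ulsubmx a 1 1 == 0 then 0 else q%:R * phi (ulsubmx a 0 1))
      * matrix_kloosterman phi (drsubmx a)
  else 0.
Proof.
rewrite transvection_averaging (eq_bigl _ _ moves_drift0).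
rewrite (sum_block_upper phiP a (fun x => x *m f0 == f1)); case: ifP => // _.
rewrite (@sum_companion2 _ al) //.
by have := a_e1; rewrite mul_e1 /e1 scale_col_mx => /(congr1 (@usubmx F 2 m 1));
  rewrite !col_mxKu.
Qed.
End PlaneSums.

(** * Eigenvectors, adapted bases and characteristic polynomials of blocks *)
Section CharPolyBlocks.
Variable F : fieldType.

Lemma char_poly_ublock m1 m2 (A : 'M[F]_m1) B (D : 'M[F]_m2) :
  char_poly (block_mx A B 0 D) = char_poly A * char_poly D.
Proof.
rewrite /char_poly /char_poly_mx map_block_mx scalar_mx_block opp_block_mx.
by rewrite add_block_mx map_mx0 oppr0 addr0 add0r det_ublock.
Qed.

Lemma char_poly_conj n (g a : 'M[F]_n) : g \in unitmx ->
  char_poly (invmx g *m a *m g) = char_poly a.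
Proof.
move=> Ug; rewrite /char_poly /char_poly_mx !map_mxM map_invmx.
set g' := map_mx _ g; have Ug' : g' \in unitmx by rewrite map_unitmx.
set a' := map_mx _ a.
have -> : 'X%:M - invmx g' *m a' *m g' = invmx g' *m ('X%:M - a') *m g'.
  by rewrite mulmxBr mulmxBl scalar_mxC mulmxKV.
by rewrite !det_mulmx mulrAC -det_mulmx mulVmx // det1 mul1r.
Qed.

Lemma monic_divisor_exp_XsubC (al : F) n m (p r : {poly F}) : p \is monic ->
  size p = m.+1 -> p * r = ('X - al%:P) ^+ n -> p = ('X - al%:P) ^+ m.
Proof.
move=> mp sp pr; have : p %| ('X - al%:P) ^+ n by rewrite -pr dvdp_mulr.
case/dvdp_exp_XsubCP => k [_ eqp_k].
have mk : ('X - al%:P) ^+ k \is monic by rewrite monic_exp ?monicXsubC.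
have pE : p = ('X - al%:P) ^+ k by apply/eqP; rewrite -(eqp_monic mp mk).
by move: sp; rewrite pE size_exp_XsubC => -[->].
Qed.

Lemma char_poly_ublock_exp (al : F) m1 m2 (A : 'M[F]_m1) B (D : 'M[F]_m2) :
  char_poly (block_mx A B 0 D) = ('X - al%:P) ^+ (m1 + m2) ->
  char_poly A = ('X - al%:P) ^+ m1 /\ char_poly D = ('X - al%:P) ^+ m2.
Proof.
rewrite char_poly_ublock => cp; split.
  by apply: monic_divisor_exp_XsubC cp; rewrite ?char_poly_monic ?size_char_poly.
rewrite mulrC in cp.
by apply: monic_divisor_exp_XsubC cp; rewrite ?char_poly_monic ?size_char_poly.
Qed.

Lemma char_poly_eigenvector (al : F) n (a : 'M[F]_n.+1) :
  char_poly a = ('X - al%:P) ^+ n.+1 -> exists2 v : 'cV_n.+1, v != 0 & a *m v = al *: v.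
Proof.
move=> cp; have : eigenvalue a al.
  by rewrite eigenvalue_root_char cp rootE horner_exp hornerXsubC subrr expr0n.
rewrite /eigenvalue => ev; have : \det (a - al%:M)^T == 0.
  rewrite det_tr; apply: contraNT ev => nz_det.
  rewrite /eigenspace kermx_eq0 row_free_unit unitmxE unitfE //.
case/det0P => v nz_v va; exists v^T.
  by apply: contraNneq nz_v => v0; rewrite -[v]trmxK v0 trmx0.
have : (a - al%:M) *m v^T = 0 by rewrite -[LHS]trmxK trmx_mul trmxK va trmx0.
by rewrite mulmxBl mul_scalar_mx => /eqP; rewrite subr_eq0 => /eqP.
Qed.

(** A nonzero column has rank one, so its Gaussian factorization expresses it as
    a scalar times the first column of an invertible matrix. *)
Lemma unitmx_with_first_column n (w : 'cV[F]_n.+1) : w != 0 ->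
  exists2 g, g \in unitmx & g *m delta_mx 0 0 = w.
Proof.
move=> nz_w; have rk1 : \rank w = 1%N.
  by apply/eqP; rewrite eqn_leq rank_leq_col lt0n mxrank_eq0.
pose c := row_ebase w 0 0.
have nz_c : c != 0.
  by have := row_ebase_unit w; rewrite unitmxE unitfE [row_ebase w]mx11_scalar det_scalar1.
exists (col_ebase w *m c%:M).
  by rewrite unitmx_mul col_ebase_unit unitmxE det_scalar unitfE expf_neq0.
rewrite -[RHS]mulmx_ebase rk1 -!mulmxA; congr (_ *m _).
rewrite [row_ebase w]mx11_scalar mul_mx_scalar mul_scalar_mx; congr (_ *: _).
apply/matrixP => i j; rewrite !mxE (ord1 j) eqxx andbT.
by case: i => [[|i] Hi]; rewrite -?val_eqE //=.
Qed.

Lemma delta00_col_mx m : (delta_mx 0 0 : 'cV[F]_(1 + m)) = col_mx 1%:M 0.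
Proof.
apply/colP => i; rewrite [RHS]mxE; case: splitP => k Hk; rewrite !mxE ?(ord1 k) //=.
  by rewrite -val_eqE /= Hk (ord1 k).
by rewrite -val_eqE /= Hk.
Qed.

Lemma unitmx_second_column m (w : 'cV[F]_(1 + m.+1)) : dsubmx w != 0 ->
  exists g : 'M[F]_m.+2, [/\ g \in unitmx,
    g *m delta_mx 0 0 = delta_mx 0 0 :> 'cV_m.+2 & g *m delta_mx 1 0 = w].
Proof.
move=> /unitmx_with_first_column[g' Ug' g'E].
have d1 : (delta_mx 1 0 : 'cV[F]_(1 + m.+1)) = col_mx 0 (delta_mx 0 0).
  apply/colP => i; rewrite [RHS]mxE; case: splitP => k Hk; rewrite !mxE ?(ord1 k) //=.
    by rewrite -val_eqE /= Hk (ord1 k).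
  by rewrite -!val_eqE /= Hk.
pose g : 'M[F]_(1 + m.+1) := block_mx 1%:M (usubmx w *m delta_mx 0 0) 0 g'.
have Ug : g \in unitmx by rewrite unitmx_ublock unitmx1.
have g0 : g *m (delta_mx 0 0 : 'cV_(1 + m.+1)) = delta_mx 0 0.
  by rewrite delta00_col_mx mul_block_col !mulmx0 mul0mx mul1mx !addr0.
have g1 : g *m (delta_mx 1 0 : 'cV_(1 + m.+1)) = w.
  rewrite d1 mul_block_col !mulmx0 !add0r g'E -mulmxA mul_delta_mx.
  by rewrite -[RHS]vsubmxK; congr col_mx; apply/colP => i; rewrite (ord1 i) !mxE
    big_ord1 !mxE mulr1.
by exists g.
Qed.
End CharPolyBlocks.

(** * Splitting the matrix sum by the image of an eigenvector *)
Section Recursion.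
Variables (F : finFieldType) (C : numFieldType) (phi : F -> C) (al : F).
Hypothesis phiP : nontrivial_character phi.
Local Notation q := #|F|.
Local Notation K a := (matrix_kloosterman phi a).
Local Notation K1 := (kloosterman_sum phi al).
Local Notation e1 m := (delta_mx 0 0 : 'cV[F]_m.+1).
Local Notation e2 m := (delta_mx 1 0 : 'cV[F]_m.+2).

Lemma mul_e1_1 m (x : 'M[F]_(1 + m)) :
  x *m (delta_mx 0 0 : 'cV_(1 + m)) = col_mx (ulsubmx x) (dlsubmx x).
Proof. by rewrite delta00_col_mx -{1}[x]submxK mul_block_col !mulmx0 !mulmx1 !addr0. Qed.

Lemma eigen_e1_blocks m (a : 'M[F]_(1 + m)) :
  a *m (delta_mx 0 0 : 'cV_(1 + m)) = al *: (delta_mx 0 0 : 'cV_(1 + m)) ->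
  ulsubmx a = al%:M /\ dlsubmx a = 0.
Proof.
rewrite mul_e1_1 delta00_col_mx. rewrite scale_col_mx scaler0 => eq_col; split.
  have := congr1 (@usubmx F 1 m 1) eq_col; rewrite !col_mxKu => ->.
  by rewrite scale_scalar_mx mulr1.
by have := congr1 (@dsubmx F 1 m 1) eq_col; rewrite !col_mxKd.
Qed.

Lemma sum_line m (a : 'M[F]_(1 + m)) :
  a *m (delta_mx 0 0 : 'cV_(1 + m)) = al *: (delta_mx 0 0 : 'cV_(1 + m)) ->
  \sum_(x : 'M[F]_(1 + m) | (x \in unitmx) && (dlsubmx x == 0))
    kloosterman_phase phi a x = (q ^ m)%:R * K1 * K (drsubmx a).
Proof.
move=> /eigen_e1_blocks[ul dl].
have := sum_block_upper phiP a xpredT; rewrite dl eqxx ul mul1n => sumE.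
rewrite (eq_bigl (fun x : 'M[F]_(1 + m) => [&& x \in unitmx, dlsubmx x == 0 & true])).
  rewrite sumE; congr (_ * _ * _).
  rewrite (eq_bigl (fun x : 'M[F]_1 => x \in unitmx)) => [|x]; last by rewrite andbT.
  by have := matrix_kloosterman1 phi (al%:M : 'M_1); rewrite mxE eqxx.
by move=> x; rewrite andbT.
Qed.

Lemma kloosterman_line_split m (a : 'M[F]_m.+2) : a *m e1 m.+1 = al *: e1 m.+1 ->
  K a = (q ^ m.+1)%:R * K1 * K (drsubmx (a : 'M_(1 + m.+1))) +
    \sum_(w : 'cV[F]_(1 + m.+1) | dsubmx w != 0)
      \sum_(x | (x \in unitmx) && (x *m e1 m.+1 == w)) kloosterman_phase phi a x.
Proof.
move=> a_e1; rewrite -(@sum_line m.+1 a) // /matrix_kloosterman.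
rewrite (bigID (fun x : 'M[F]_(1 + m.+1) => dlsubmx x == 0)) /=; congr (_ + _).
rewrite (partition_big (fun x : 'M[F]_(1 + m.+1) => x *m (delta_mx 0 0 : 'cV_(1 + m.+1)))
  (fun w : 'cV[F]_(1 + m.+1) => dsubmx w != 0)) => [|x /andP[_]]; last first.
  by rewrite mul_e1_1 col_mxKd.
apply: eq_bigr => w nz_w; apply: eq_bigl => x; rewrite -andbA; congr (_ && _).
case: (eqVneq _ w) => [xw|]; last by rewrite andbF.
by rewrite andbT -nz_w -xw mul_e1_1 col_mxKd.
Qed.

(** The matrix g is a change of basis that fixes e1 and takes e2 to w; conjugation
    by g turns the condition x e1 = w into x e1 = e2. *)
Lemma sum_moved_vector m (a : 'M[F]_m.+2) (w : 'cV[F]_(1 + m.+1)) :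
  a *m e1 m.+1 = al *: e1 m.+1 -> dsubmx w != 0 ->
  exists g : 'M[F]_m.+2, g \in unitmx /\
    let b : 'M[F]_(2 + m) := invmx g *m a *m g in
    b *m (delta_mx 0 0 : 'cV_(2 + m)) = al *: (delta_mx 0 0 : 'cV_(2 + m)) /\
    \sum_(x | (x \in unitmx) && (x *m e1 m.+1 == w)) kloosterman_phase phi a x =
    if dlsubmx b == 0 then
      (q ^ (2 * m))%:R
        * (if ulsubmx b 1 1 == 0 then 0 else q%:R * phi (ulsubmx b 0 1))
        * K (drsubmx b)
    else 0.
Proof.
move=> a_e1 /unitmx_second_column[g [Ug g0 g1]]; exists g; split=> // b.
have ginv0 : invmx g *m e1 m.+1 = e1 m.+1 by rewrite -{1}g0 mulKmx.
have b_e1 : b *m e1 m.+1 = al *: e1 m.+1.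
  by rewrite /b -!mulmxA g0 a_e1 -scalemxAr ginv0.
split=> //.
have d0 : (delta_mx 0 0 : 'cV[F]_(2 + m)) = col_mx (delta_mx 0 0) 0.
  apply/colP => i; rewrite [RHS]mxE; case: splitP => k Hk; rewrite !mxE //=.
    by rewrite -!val_eqE /= Hk.
  by rewrite -val_eqE /= Hk.
have d1 : (delta_mx 1 0 : 'cV[F]_(2 + m)) = col_mx (delta_mx 1 0) 0.
  apply/colP => i; rewrite [RHS]mxE; case: splitP => k Hk; rewrite !mxE //=.
    by rewrite -!val_eqE /= Hk.
  by rewrite -!val_eqE /= Hk.
rewrite -(sum_moves phiP (al := al)); last by rewrite -d0.
rewrite (sum_conj phi a (fun x => x *m e1 m.+1 == w) Ug) -/b; apply: eq_bigl => x.
rewrite -d0 -d1; congr (_ && _); rewrite -!mulmxA ginv0 -g1.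
by rewrite (inj_eq (can_inj (mulKmx Ug))).
Qed.
End Recursion.

(** * The recursion in the dimension *)

(** The sequence of the sums K_n(alpha I), for k1 = K_1 and c = 0 or 1 according
    as alpha is zero or not.  The factor q^n - q is the number of vectors off the
    line of e1, in dimension n. *)
Fixpoint scalar_recursion (C : nzRingType) (q : nat) (k1 c : C) (n : nat) : C :=
  match n with
  | 0 => 1
  | n1.+1 => match n1 with
    | 0 => k1
    | n2.+1 => (q ^ n1)%:R * k1 * scalar_recursion q k1 c n1 +
        (q ^ n - q)%:R * ((q ^ (2 * n2))%:R * (c * q%:R) * scalar_recursion q k1 c n2)
    end
  end.

Lemma scalar_recursionSS (C : nzRingType) q (k1 c : C) n :
  scalar_recursion q k1 c n.+2 =
    (q ^ n.+1)%:R * k1 * scalar_recursion q k1 c n.+1 +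
    (q ^ n.+2 - q)%:R * ((q ^ (2 * n))%:R * (c * q%:R) * scalar_recursion q k1 c n).
Proof. by []. Qed.

Lemma scalar_recursion_ge0 (C : numDomainType) q (k1 c : C) n : 0 <= k1 -> 0 <= c ->
  0 <= scalar_recursion q k1 c n.
Proof.
move=> k1_ge0 c_ge0; elim/ltn_ind: n => -[|[|n]] IH //.
by rewrite scalar_recursionSS addr_ge0 ?mulr_ge0 ?ler0n ?IH.
Qed.

(** The n-th term is a polynomial in k1 of the parity of n, so a sign of k1 only
    changes the sign of the terms. *)
Lemma scalar_recursion_sign (C : comNzRingType) q (s k1 c : C) n : s * s = 1 ->
  scalar_recursion q (s * k1) c n = s ^+ n * scalar_recursion q k1 c n.
Proof.
move=> ss; elim/ltn_ind: n => -[|[|n]] IH; [by rewrite mul1r | by rewrite expr1 |].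
rewrite !scalar_recursionSS !IH //.
have -> : s ^+ n.+2 = s ^+ n by rewrite !exprS mulrA ss mul1r.
rewrite exprS.
have -> : (q ^ n.+1)%:R * (s * k1) * (s * s ^+ n * scalar_recursion q k1 c n.+1) =
  s * s * (s ^+ n * ((q ^ n.+1)%:R * k1 * scalar_recursion q k1 c n.+1)) by ring.
by rewrite ss; ring.
Qed.

Section UniqueEigenvalue.
Variables (F : finFieldType) (C : numFieldType) (phi : F -> C) (al : F).
Hypotheses (phiP : nontrivial_character phi) (phi_norm : forall x, `|phi x| = 1).
Local Notation q := #|F|.
Local Notation K a := (matrix_kloosterman phi a).
Local Notation K1 := (kloosterman_sum phi al).
Local Notation cal := ((al != 0)%:R : C).

Lemma card_outside_line m :
  #|[pred w : 'cV[F]_(1 + m.+1) | dsubmx w != 0]| = (q ^ m.+2 - q)%N.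
Proof.
have card_line : #|[pred w : 'cV[F]_(1 + m.+1) | dsubmx w == 0]| = q.
  have -> : q = #|[set: F]| by rewrite cardsT.
  pose line (c : F) : 'cV[F]_(1 + m.+1) := col_mx c%:M 0.
  have line_inj : injective line.
    move=> c d /(congr1 (@usubmx F 1 m.+1 1)); rewrite !col_mxKu.
    by move=> /matrixP/(_ 0 0); rewrite !mxE eqxx !mulr1n.
  rewrite -(card_imset _ line_inj); apply: eq_card => w; rewrite inE.
  apply/eqP/imsetP => [w0|[c _ ->]]; last by rewrite col_mxKd.
  by exists (usubmx w 0 0); rewrite // /line -mx11_scalar -{1}[w]vsubmxK w0.
have := cardC [pred w : 'cV[F]_(1 + m.+1) | dsubmx w == 0].
rewrite card_line card_mx muln1 => <-; rewrite addKn; apply: eq_card => w.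
by rewrite !inE.
Qed.

Lemma matrix_kloosterman_scalar n :
  K (al%:M : 'M[F]_n) = scalar_recursion q K1 cal n.
Proof.
have [phi0 _ _] := phiP.
elim/ltn_ind: n => -[|[|m]] IH.
- exact: matrix_kloosterman0.
- by rewrite matrix_kloosterman1 mxE eqxx.
rewrite scalar_recursionSS.
have a_e1 : (al%:M : 'M[F]_m.+2) *m (delta_mx 0 0 : 'cV_m.+2)
    = al *: (delta_mx 0 0 : 'cV_m.+2).
  exact: mul_scalar_mx.
rewrite (kloosterman_line_split phiP a_e1); congr (_ + _).
  by rewrite (scalar_mx_block 1 m.+1) block_mxKdr IH.
transitivity (\sum_(w : 'cV[F]_(1 + m.+1) | dsubmx w != 0)
  (q ^ (2 * m))%:R * (cal * q%:R) * scalar_recursion q K1 cal m).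
  apply: eq_bigr => w nz_w.
  have [g [Ug [_ ->]]] := sum_moved_vector phiP a_e1 nz_w.
  have -> : invmx g *m al%:M *m g = al%:M by rewrite scalar_mxC mulmxKV.
  rewrite (scalar_mx_block 2 m) block_mxKul block_mxKdl block_mxKdr eqxx IH //.
  congr (_ * _ * _); rewrite !mxE /= mulr0n phi0 mulr1 mulr1n.
  by case: eqP => _; rewrite ?mul0r ?mul1r.
by rewrite sumr_const card_outside_line [RHS]mulr_natl.
Qed.

(** Each vector w off the line of e1 contributes at most as much as in the scalar
    case, by [sum_moved_vector] and the bound in dimension n - 2.  For alpha = 0
    the contributions vanish, as the plane sum contains a factor that is 0 unless d <> 0,
    where d is the second diagonal entry of a on the plane, and the trace of a on
    the plane shows that d = alpha. *)
Lemma matrix_kloosterman_le n (a : 'M[F]_n) : char_poly a = ('X - al%:P) ^+ n ->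
  `|K a| <= scalar_recursion q `|K1| cal n.
Proof.
elim/ltn_ind: n a => -[|[|m]] IH a cp.
- by rewrite matrix_kloosterman0 // normr1.
- rewrite matrix_kloosterman1 // (_ : a 0 0 = al) //.
  have := char_poly_trace a (ltn0Sn 0); rewrite cp expr1 coefB coefX coefC sub0r.
  by move/oppr_inj; rewrite /mxtrace big_ord1.
have [v nz_v av] := char_poly_eigenvector cp.
have [g Ug g0] := unitmx_with_first_column nz_v.
rewrite -(matrix_kloosterman_conj phi a Ug).
rewrite -(char_poly_conj a Ug) in cp.
have a_e1 : (invmx g *m a *m g) *m (delta_mx 0 0 : 'cV_m.+2)
    = al *: (delta_mx 0 0 : 'cV_m.+2).
  by rewrite -!mulmxA g0 av -scalemxAr -g0 mulKmx.
move: (invmx g *m a *m g) cp a_e1 => {g Ug g0 av nz_v v}a cp a_e1.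
rewrite scalar_recursionSS (kloosterman_line_split phiP a_e1).
apply: (le_trans (ler_normD _ _)).
apply: lerD.
  rewrite !normrM normr_nat ler_wpM2l ?mulr_ge0 ?ler0n //.
  apply: IH => //; have [_ dl0] := eigen_e1_blocks (a_e1 : (a : 'M_(1 + m.+1)) *m _ = _).
  move: cp; rewrite -[a](@submxK _ 1 m.+1 1 m.+1) dl0.
  by move=> /(@char_poly_ublock_exp _ _ 1 m.+1)[_]; rewrite block_mxKdr.
apply: (le_trans (ler_norm_sum _ _ _)).
have le_w (w : 'cV[F]_(1 + m.+1)) : dsubmx w != 0 ->
  `|\sum_(x | (x \in unitmx) && (x *m (delta_mx 0 0 : 'cV_m.+2) == w))
      kloosterman_phase phi a x|
    <= (q ^ (2 * m))%:R * (cal * q%:R) * scalar_recursion q `|K1| cal m.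
  move=> nz_w; have [g [Ug [b_e1 ->]]] := sum_moved_vector phiP a_e1 nz_w.
  have rec_ge0 : 0 <= scalar_recursion q `|K1| cal m.
    by rewrite scalar_recursion_ge0 ?ler0n.
  have := char_poly_conj a Ug; rewrite {}cp.
  set b : 'M[F]_(2 + m) := invmx g *m a *m g in b_e1 *.
  case: eqVneq => [dl0 cpb|_ _]; last by rewrite normr0 !mulr_ge0 ?ler0n.
  have cpb' : char_poly (block_mx (ulsubmx b) (ursubmx b) 0 (drsubmx b))
      = ('X - al%:P) ^+ (2 + m).
    by rewrite -dl0 submxK.
  have [cp_ul cp_dr] := char_poly_ublock_exp cpb'.
  rewrite !normrM normr_nat -!mulrA ler_wpM2l ?ler0n // mulrA.
  apply: ler_pM; rewrite ?normr_ge0 //; last exact: IH.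
  case: (eqVneq (ulsubmx b 1 1)) => [_|nz_b11]; first by rewrite normr0 mulr_ge0 ?ler0n.
  rewrite normrM normr_nat phi_norm mulr1.
  suff -> : al != 0 by rewrite mul1r.
  apply: contraNneq nz_b11 => al0.
  have := char_poly_trace (ulsubmx b) (ltn0Sn 1); rewrite cp_ul al0 subr0 coefXn /=.
  move/eqP; rewrite eq_sym oppr_eq0 /mxtrace !big_ord_recl big_ord0 addr0.
  have -> : ulsubmx b ord0 ord0 = 0.
    move: b_e1; rewrite al0 scale0r -colE; move: (b) => b' /colP/(_ ord0).
    by rewrite !mxE => b00; rewrite -[RHS]b00; congr (b' _ _); apply: val_inj.
  by rewrite add0r (_ : lift ord0 ord0 = 1) //; apply: val_inj.
apply: (le_trans (ler_sum _ le_w)).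
by rewrite sumr_const card_outside_line [leRHS]mulr_natl.
Qed.

Lemma norm_matrix_kloosterman_scalar n (s : C) : s * s = 1 -> K1 = s * `|K1| ->
  `|K (al%:M : 'M[F]_n)| = scalar_recursion q `|K1| cal n.
Proof.
move=> ss K1E; rewrite matrix_kloosterman_scalar K1E.
rewrite scalar_recursion_sign // normrM -K1E.
rewrite [X in _ * X]ger0_norm ?scalar_recursion_ge0 ?ler0n // normrX.
suff -> : `|s| = 1 by rewrite expr1n mul1r.
apply/eqP; rewrite -(@eqrXn2 _ 2) // expr1n -normrX expr2 ss normr1.
by [].
Qed.
End UniqueEigenvalue.

(** * Growth of the recursion *)
Section RatioBounds.
(** Here Q is the order q of the field, r = sqrt q, t = 1 / (q - 1) and
    kap = |K_1| / sqrt q. *)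
Variables (R : realFieldType) (Q r t kap : R).
Hypotheses (Q_ge2 : 2 <= Q) (r2 : r ^+ 2 = Q) (r_gt0 : 0 < r).
Hypotheses (t_gt0 : 0 < t) (tQ : t * (Q - 1) = 1).
Hypotheses (kap_ge0 : 0 <= kap) (kap_le2 : kap <= 2) (kap_triv : kap * r <= Q - 1).

Let kap_t : kap * t * r <= 1.
Proof. by rewrite mulrAC -tQ [leRHS]mulrC ler_wpM2r // ltW. Qed.
Let kt_ge0 : 0 <= kap * t. Proof. by rewrite mulr_ge0 // ltW. Qed.
Let r_ge43 : 4 / 3 <= r.
Proof.
rewrite leNgt; apply/negP => lt_r; have : r * r <= 4 / 3 * (4 / 3).
  by apply: ler_pM; rewrite ltW.
by rewrite -expr2 r2; have := Q_ge2; lra.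
Qed.

(** The trivial bound gives kap t <= 1 / r, and r >= 4 / 3. *)
Lemma even_ratio_le4 : 1 + 4 * (kap * t) <= 4.
Proof. by have := kap_t; have := r_ge43; have := kt_ge0; nra. Qed.

(** The left hand side is kap + kap t + 4 (kap t)^2.  For q <= 4 the trivial bound
    on K_1 gives at most r + 4 / q, hence at most 2 + 2; for q >= 5 Weil's bound
    kap <= 2 gives at most 2 + 1/2 + 1. *)
Lemma odd_ratio_le4 : (Q <= 4) || (5 <= Q) ->
  kap * (1 + (1 + 4 * (kap * t)) * t) <= 4.
Proof.
have -> : kap * (1 + (1 + 4 * (kap * t)) * t) = kap + kap * t + 4 * (kap * t) ^+ 2.
  by ring.
case/orP => [Q_le4|Q_ge5].
  have r_le2 : r <= 2.
    rewrite leNgt; apply/negP => gt_r; have : 2 * 2 < r * r by apply: ltr_pM.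
    by rewrite -[r * r]expr2 r2; lra.
  have h1 : kap + kap * t <= r.
    rewrite -(ler_pM2r r_gt0) -expr2 r2 mulrDl.
    by have := kap_t; have := kap_triv; lra.
  have h2 : (kap * t) ^+ 2 * Q <= 1.
    rewrite -r2 -exprMn -[leRHS](expr1n _ 2) ler_pXn2r ?nnegrE //.
    by rewrite mulr_ge0 // ltW.
  have : (kap * t) ^+ 2 * 2 <= (kap * t) ^+ 2 * Q by rewrite ler_wpM2l ?sqr_ge0.
  by lra.
have t_le : t <= 1 / 4.
  by have := tQ; have := t_gt0; nra.
have kt_le : kap * t <= 1 / 2.
  by have := t_gt0; have := kap_ge0; have := kap_le2; nra.
have : (kap * t) ^+ 2 <= 1 / 4 by have := kt_ge0; nra.
by have := kap_le2; lra.
Qed.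
End RatioBounds.

Section NumericBound.
Variables (R : rcfType) (q : nat) (k c : R).
Hypotheses (q_gt1 : (1 < q)%N) (k_ge0 : 0 <= k) (c_ge0 : 0 <= c) (c_le1 : c <= 1).
Hypotheses (k_triv : k <= q%:R - 1) (k_weil : k ^+ 2 <= 4 * q%:R).

Let Q : R := q%:R.
Let r : R := Num.sqrt Q.

(** After normalization the even terms E_j and the odd terms O_j satisfy
    E_(j+1) <= E_j + kap q^-(j+1) O_j and O_(j+1) <= O_j + kap q^-(j+1) E_(j+1). *)
Lemma scalar_recursion_parity j :
  scalar_recursion q k c (2 * j) <= 4 * Q ^+ (3 * j * j) /\
  scalar_recursion q k c (2 * j).+1 <= 4 * (Q ^+ (3 * j * j + 3 * j) * r).
Proof.
pose kap := k / r; pose t := (Q - 1)^-1.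
have Q_ge2 : 2 <= Q by rewrite /Q (ler_nat _ 2).
have Q_gt0 : 0 < Q by apply: lt_le_trans Q_ge2.
have r2 : r ^+ 2 = Q by rewrite sqr_sqrtr // ltW.
have r_gt0 : 0 < r by rewrite sqrtr_gt0.
have Q1_gt0 : 0 < Q - 1 by rewrite subr_gt0 (lt_le_trans _ Q_ge2) ?ltr1n.
have kE : k = kap * r by rewrite /kap divfK ?gt_eqF.
have kap_ge0 : 0 <= kap by rewrite divr_ge0 // ltW.
have t_gt0 : 0 < t by rewrite invr_gt0.
have tQ : t * (Q - 1) = 1 by rewrite mulVf ?gt_eqF.
have kap_le2 : kap <= 2.
  rewrite /kap ler_pdivrMr // -(@ler_pXn2r _ 2) ?nnegrE ?mulr_ge0 ?(ltW r_gt0) //.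
  by rewrite exprMn r2 -natrX.
have kap_triv : kap * r <= Q - 1 by rewrite -kE.
have Em4 := even_ratio_le4 Q_ge2 r2 r_gt0 t_gt0 tQ kap_ge0 kap_triv.
have Q_split : (Q <= 4) || (5 <= Q).
  by rewrite (ler_nat _ _ 4) (ler_nat _ 5) leqNgt orNb.
have Om4 := odd_ratio_le4 Q_ge2 r2 r_gt0 t_gt0 tQ kap_ge0 kap_le2 kap_triv Q_split.
set Em := 1 + 4 * (kap * t) in Em4 Om4.
have Em_ge0 : 0 <= Em.
  by apply: addr_ge0 => //; do 2!apply: mulr_ge0 => //; apply: ltW.
(* u j is the sum of q^-i for i from 1 to j, hence at most t *)
pose u j := t * (1 - (Q ^+ j)^-1).
have u_le j' : u j' <= t.
  by rewrite /u ler_piMr ?(ltW t_gt0) // gerBl invr_ge0 exprn_ge0 // ltW.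
have uS j' : u j'.+1 = u j' + (Q ^+ j'.+1)^-1.
  have -> : (Q ^+ j'.+1)^-1 = t * (Q - 1) * (Q ^+ j'.+1)^-1 by rewrite tQ mul1r.
  by rewrite /u exprS; field; rewrite expf_neq0 ?gt_eqF.
have even_u j' : 1 + 4 * (kap * u j') <= Em.
  by rewrite lerD2l ler_wpM2l // ler_wpM2l.
have odd_u j' : kap * (1 + Em * u j') <= kap * (1 + Em * t).
  by rewrite ler_wpM2l // lerD2l ler_wpM2l.
suff [even_j odd_j] :
  scalar_recursion q k c (2 * j) <= Q ^+ (3 * j * j) * (1 + 4 * (kap * u j)) /\
  scalar_recursion q k c (2 * j).+1 <=
    Q ^+ (3 * j * j + 3 * j) * r * (kap * (1 + Em * u j)).
  split.
    apply: (le_trans even_j); rewrite mulrC ler_wpM2r ?exprn_ge0 ?(ltW Q_gt0) //.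
    exact: le_trans (even_u j) Em4.
  apply: (le_trans odd_j); rewrite mulrC ler_wpM2r //.
    by rewrite mulr_ge0 ?exprn_ge0 ?(ltW Q_gt0) ?(ltW r_gt0).
  exact: le_trans (odd_u j) Om4.
have natB_le n : (q ^ n - q)%:R <= Q ^+ n :> R by rewrite -natrX ler_nat leq_subr.
have rec_ge0 := scalar_recursion_ge0 q _ k_ge0 c_ge0.
elim: j => [|j [IHe IHo]].
  rewrite !muln0 !expr0 !mul1r /u expr0 invr1 subrr !mulr0 !addr0 mulr1 /=.
  by rewrite mulrC -kE lexx lexx.
have -> : (2 * j.+1 = (2 * j).+2)%N by rewrite mulnS.
have step n (X Y : R) : scalar_recursion q k c n.+1 <= X -> scalar_recursion q k c n <= Y ->
    scalar_recursion q k c n.+2 <= Q ^+ n.+1 * k * X + Q ^+ n.+2 * (Q ^+ (2 * n) * (Q * Y)).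
  move=> leX leY; rewrite scalar_recursionSS natrX; apply: lerD.
    by rewrite ler_wpM2l // mulr_ge0 ?exprn_ge0 ?(ltW Q_gt0).
  apply: ler_pM; rewrite ?ler0n // ?mulr_ge0 ?ler0n //.
  rewrite natrX -!mulrA ler_wpM2l ?exprn_ge0 ?(ltW Q_gt0) //.
  rewrite mulrA; apply: ler_pM; rewrite ?mulr_ge0 ?ler0n //.
  by rewrite ler_piMl // ltW.
pose x := Q ^+ j; have nz_x : x != 0 by rewrite expf_neq0 // gt_eqF.
have x_gt0 : 0 < x by rewrite exprn_gt0.
pose A := Q ^+ (3 * j * j).
have A_gt0 : 0 < A by rewrite exprn_gt0.
have x2 m : Q ^+ (m * j) = x ^+ m by rewrite mulnC exprM.
have AS : Q ^+ (3 * j.+1 * j.+1) = A * x ^+ 6 * Q ^+ 3.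
  by rewrite /A -x2 -!exprD; congr (_ ^+ _); ring.
have BE : Q ^+ (3 * j * j + 3 * j) = A * x ^+ 3 by rewrite exprD (x2 3%N).
have BS : Q ^+ (3 * j.+1 * j.+1 + 3 * j.+1) = A * x ^+ 9 * Q ^+ 6.
  by rewrite /A -x2 -!exprD; congr (_ ^+ _); ring.
have Q1 : Q ^+ (2 * j).+1 = Q * x ^+ 2 by rewrite exprS x2.
have Q2 : Q ^+ (2 * j).+2 = Q ^+ 2 * x ^+ 2 by rewrite exprS Q1 mulrA -expr2.
have Q3 : Q ^+ (2 * j).+3 = Q ^+ 3 * x ^+ 2.
  by rewrite exprS Q2 mulrA -exprS.
have Q4 : Q ^+ (2 * (2 * j)) = x ^+ 4 by rewrite mulnA x2.
have Q5 : Q ^+ (2 * (2 * j).+1) = Q ^+ 2 * x ^+ 4 by rewrite mulnS exprD Q4.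
have uxS : u j.+1 = u j + (x * Q)^-1 by rewrite uS exprSr.
have even_S : scalar_recursion q k c (2 * j).+2 <=
    Q ^+ (3 * j.+1 * j.+1) * (1 + 4 * (kap * u j.+1)).
  have IHo' : scalar_recursion q k c (2 * j).+1 <= A * x ^+ 3 * r * 4.
    apply: (le_trans IHo); rewrite BE ler_wpM2l //.
      by rewrite !mulr_ge0 ?exprn_ge0 ?(ltW Q_gt0) ?(ltW r_gt0) ?(ltW A_gt0) ?(ltW x_gt0).
    exact: le_trans (odd_u j) Om4.
  apply: (le_trans (step _ _ _ IHo' IHe)); rewrite -/A AS uxS.
  rewrite Q1 Q2 Q4 kE.
  have -> : Q * x ^+ 2 * (kap * r) * (A * x ^+ 3 * r * 4) =
     Q * x ^+ 5 * kap * A * r ^+ 2 * 4 by ring.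
  rewrite r2 le_eqVlt; apply/orP; left; apply/eqP.
  by field; rewrite nz_x gt_eqF.
split=> //.
have even_S' : scalar_recursion q k c (2 * j).+2 <= A * x ^+ 6 * Q ^+ 3 * Em.
  apply: (le_trans even_S); rewrite AS ler_wpM2l //.
  by rewrite !mulr_ge0 ?exprn_ge0 ?(ltW Q_gt0) ?(ltW r_gt0) ?(ltW A_gt0) ?(ltW x_gt0).
apply: (le_trans (step _ _ _ even_S' IHo)); rewrite BE BS uxS.
rewrite Q2 Q3 Q5 kE le_eqVlt; apply/orP; left; apply/eqP.
by field; rewrite nz_x gt_eqF.
Qed.
End NumericBound.

(** * Stepanov's bound for the values of a trace *)
Section Frob.
Variables (E : comNzRingType) (q : nat).
Hypothesis frobD : forall x y : E, (x + y) ^+ q = x ^+ q + y ^+ q.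
Hypothesis q_gt0 : (0 < q)%N.

Lemma frob_iterD i (x y : E) : (x + y) ^+ (q ^ i) = x ^+ (q ^ i) + y ^+ (q ^ i).
Proof. by elim: i => [|i IH]; rewrite ?expn0 // expnSr !exprM IH frobD. Qed.

Lemma frob_iter_sum i I (r : seq I) (P : pred I) (f : I -> E) :
  (\sum_(k <- r | P k) f k) ^+ (q ^ i) = \sum_(k <- r | P k) f k ^+ (q ^ i).
Proof.
apply: (big_morph (fun x : E => x ^+ (q ^ i))); first exact: frob_iterD.
by rewrite expr0n expn_eq0 eqn0Ngt q_gt0.
Qed.
End Frob.

Lemma sum_size_increasing_neq0 (E : idomainType) N e (h : 'I_N -> {poly E}) (c : 'I_N -> E) :
  (forall t, size (h t) = (t + e).+1) -> (exists t, c t != 0) ->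
  \sum_t c t *: h t != 0.
Proof.
move=> szh [t1 ct1].
have [t0 ct0 max_t0] := @arg_maxnP _ t1 (fun t => c t != 0) val ct1.
apply/negP => /eqP /(congr1 (fun p : {poly E} => p`_(t0 + e))).
rewrite coef0 coef_sum (bigD1 t0) //= big1 ?addr0 => [|t ne_t].
  rewrite coefZ => /eqP; rewrite mulf_eq0 (negPf ct0) /=.
  have := lead_coef_eq0 (h t0); rewrite lead_coefE szh /= => ->.
  by rewrite -size_poly_eq0 szh.
rewrite coefZ; have [->|ct] := eqVneq (c t) 0; first by rewrite mul0r.
have lt_t: (t < t0)%N by rewrite ltn_neqAle ne_t; exact: max_t0.
by rewrite nth_default ?mulr0 // szh ltn_add2r.
Qed.

(** There are more polynomials than coefficients. *)
Lemma nontrivial_relation (E : fieldType) N m (B : 'I_N -> {poly E}) :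
  (forall t, size (B t) <= m)%N -> (m < N)%N ->
  exists c : 'I_N -> E, (exists t, c t != 0) /\ \sum_t c t *: B t = 0.
Proof.
move=> szB ltmN; pose A := \matrix_(t < N, s < m) (B t)`_s.
have : kermx A != 0.
  rewrite kermx_eq0 /row_free; apply: contraTneq ltmN => <-.
  by rewrite -leqNgt rank_leq_col.
case/rowV0Pn => v /sub_kermxP vA0 nz_v.
exists (v 0); split.
  apply/existsP; apply: contraNT nz_v; rewrite negb_exists => /forallP v0.
  by apply/eqP/rowP => t; rewrite mxE; apply/eqP; rewrite -[_ == _]negbK.
apply/polyP => s; rewrite coef0 coef_sum; have [lt_s|le_s] := ltnP s m.
  have /rowP/(_ (Ordinal lt_s)) := vA0; rewrite !mxE => vA0s.
  by rewrite -[RHS]vA0s; apply: eq_bigr => t _; rewrite coefZ mxE.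
by apply: big1 => t _; rewrite coefZ nth_default ?mulr0 // (leq_trans (szB t)).
Qed.

(** In a field E of order q^(2j+2), put D = q^j, M = q^(j+1) and
    f(x) = a x + 1 / x.  The trace of f(x) is g(x) + g(x)^M, where g, the half
    trace, is the sum of the f(x)^(q^i) for i <= j.  Consider
      H(x) = sum of c_(u,i,l) x^u (x^M)^l g(x)^i  for u < D, i < q, l < D + 4.
    At a point x where the trace of f is b one has g(x)^M = b - g(x), and
    (x^M)^M = x, so that H(x)^M is the value at x of
      B(x) = sum of c_(u,i,l)^M x^(u M + l) (b - g(x))^i.
    The c^M can be chosen, not all zero, so as to make B vanish identically, since
    the number of monomials of B is less than the number of the c.  Then H
    vanishes at all these points.  But H is not zero, because its terms have
    distinct degrees u + D i + M l + constant; the degree of H bounds the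
    number of points. *)
Section Stepanov.
Variables (E : finFieldType) (q j : nat) (a b : E).
Hypothesis q_gt1 : (1 < q)%N.
Hypothesis frobD : forall x y : E, (x + y) ^+ q = x ^+ q + y ^+ q.
Hypothesis oE : #|E| = (q ^ (j.+1 + j.+1))%N.
Hypothesis nz_a : a != 0.

Let D := (q ^ j)%N.
Let M := (q ^ j.+1)%N.

Let q_gt0 : (0 < q)%N. Proof. exact: ltnW. Qed.
Let D_gt0 : (0 < D)%N. Proof. by rewrite expn_gt0 q_gt0. Qed.
Let ME : M = (q * D)%N. Proof. exact: expnS. Qed.

Definition laurent (x : E) := a * x + x^-1.
Definition half_trace x := \sum_(i < j.+1) laurent x ^+ (q ^ i).
(** The half trace multiplied by x^D, to clear its pole at 0. *)
Definition half_trace_poly : {poly E} :=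
  \sum_(i < j.+1) (a ^+ (q ^ i) *: 'X^(q ^ i + D) + 'X^(D - q ^ i)).
Local Notation G := half_trace_poly.

Lemma size_half_trace_poly : size G = (D + D).+1.
Proof.
rewrite /G big_ord_recr /= -/D subnn expr0 addrCA.
have szT : size (a ^+ D *: 'X^(D + D)) = (D + D).+1.
  by rewrite size_scale ?expf_neq0 // size_polyXn.
rewrite size_polyDl szT // ltnS.
apply: (leq_trans (size_polyD _ _)); rewrite geq_max size_polyC oner_neq0.
rewrite addn_gt0 D_gt0 andbT /=.
apply: (big_ind (fun p : {poly E} => (size p <= D + D)%N)) => [|p r sp sr|i _].
- by rewrite size_poly0.
- by rewrite (leq_trans (size_polyD _ _)) // geq_max sp sr.
have qi : (q ^ i < D)%N by rewrite ltn_exp2l.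
rewrite (leq_trans (size_polyD _ _)) // geq_max (leq_trans (size_scale_leq _ _)).
  by rewrite size_polyXn; lia.
by rewrite size_polyXn; lia.
Qed.

Lemma horner_half_trace_poly x : x != 0 -> G.[x] = x ^+ D * half_trace x.
Proof.
move=> nz_x; rewrite /G horner_sum mulr_sumr; apply: eq_bigr => i _.
have le_i : (q ^ i <= D)%N by rewrite leq_exp2l // -ltnS.
rewrite /laurent (frob_iterD frobD) !hornerE exprMn mulrDr; congr (_ + _).
  by rewrite exprD; ring.
by rewrite exprVn -[in RHS](subnK le_i) exprD mulfK // expf_neq0.
Qed.

Lemma half_trace_frob x : \sum_(i < j.+1 + j.+1) laurent x ^+ (q ^ i) = b ->
  half_trace x ^+ M = b - half_trace x.
Proof.
move=> <-; rewrite big_split_ord /= -/(half_trace x) addrAC subrr add0r.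
rewrite (frob_iter_sum frobD) //; apply: eq_bigr => i _.
by rewrite -exprM -expnD addnC.
Qed.

Let J := (D + 4)%N.
Let N := (M * J)%N.
(** The index t encodes the triple (u, i, l) in mixed radix D, q. *)
Let lo (t : nat) := (t %% D)%N.
Let mid (t : nat) := ((t %/ D) %% q)%N.
Let hi (t : nat) := (t %/ M)%N.

Let mid_lt t : (mid t < q)%N. Proof. by rewrite ltn_mod. Qed.

Definition digit_poly (t : nat) : {poly E} :=
  'X^(lo t + M * hi t) * G ^+ mid t * 'X^(D * (q.-1 - mid t)).
Definition reduced_poly (t : nat) : {poly E} :=
  'X^(lo t * M + hi t) * (b *: 'X^D - G) ^+ mid t * 'X^(D * (q.-1 - mid t)).

Let G_neq0 : G != 0.
Proof. by rewrite -size_poly_eq0 size_half_trace_poly. Qed.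

Lemma size_digit_poly t : size (digit_poly t) = (t + D * q.-1).+1.
Proof.
have szG : size (G ^+ mid t) = ((D + D) * mid t).+1.
  rewrite -[LHS]prednK ?size_exp ?size_half_trace_poly //.
  by rewrite size_poly_gt0 expf_neq0.
have nzGe : G ^+ mid t != 0 by rewrite expf_neq0.
rewrite /digit_poly -['X^_ * _]mulrC -mulrA -exprD size_Mmonic ?monicXn //.
rewrite szG size_polyXn addnS succnK addSn; congr _.+1.
have t_digits : t = (lo t + D * (mid t + q * hi t))%N.
  rewrite {1}(divn_eq t D) /lo mulnC addnC; congr (_ + _ * _)%N.
  by rewrite {1}(divn_eq (t %/ D) q) /hi ME -divnMA addnC mulnC [(D * q)%N]mulnC.
rewrite [in RHS]t_digits ME; have := mid_lt t; move: (mid t) (lo t) (hi t) => e c l lt_e.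
have /subnK <- : (e <= q.-1)%N by lia.
  rewrite addnK. move: (q.-1 - e)%N => k; ring.
Qed.

Lemma size_reduced_poly t : (t < N)%N ->
  (size (reduced_poly t) <= D * M + M + J)%N.
Proof.
move=> lt_t.
have lo_lt : (lo t < D)%N by rewrite ltn_mod.
have hi_lt : (hi t < J)%N by rewrite ltn_divLR 1?mulnC // ME muln_gt0 q_gt0.
have szB : (size ((b *: 'X^D - G)%R ^+ mid t) <= ((D + D) * mid t).+1)%N.
  apply: (leq_trans (size_poly_exp_leq _ _)); rewrite ltnS leq_mul2r.
  apply/orP; right; rewrite -ltnS.
  have: (size (b *: 'X^D - G)%R <= (D + D).+1)%N.
    rewrite (leq_trans (size_polyD _ _)) // size_polyN size_half_trace_poly.
    rewrite geq_max leqnn andbT (leq_trans (size_scale_leq _ _)) // size_polyXn.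
    by lia.
  by case: (size _) => //= n; lia.
rewrite /reduced_poly -['X^_ * _]mulrC -mulrA -exprD.
apply: (leq_trans (size_polyMleq _ _)); rewrite size_polyXn addnS succnK.
apply: (leq_trans (leq_add szB (leqnn _))).
have := mid_lt t; move: (mid t) (lo t) (hi t) lo_lt hi_lt => e c l hc hl he.
have hM : M = (D * q.-1 + D)%N by rewrite ME -mulnSr prednK // mulnC.
have h1 : (c * M + M <= D * M)%N by rewrite -mulSnr leq_mul2r hc orbT.
have h2 : ((D + D) * e + D * (q.-1 - e) <= D * q.-1 + D * q.-1)%N.
  rewrite mulnDl -addnA -mulnDr -!mulnDr leq_mul2l; apply/orP; right; lia.
lia.
Qed.

(** The degree of H is less than M (D + 4) + D (q - 1) <= D M + 5 M. *)
Lemma stepanov_bound :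
  (#|[set x : E | (x != 0%R) &&
      (\sum_(i < j.+1 + j.+1) laurent x ^+ (q ^ i) == b)%R]|
    <= D * M + 5 * M)%N.
Proof.
have ltN : (D * M + M + J < N)%N.
  have : (2 * D <= M)%N by rewrite ME leq_mul2r q_gt1 orbT.
  rewrite /N /J mulnDr; lia.
have [//|c [nz_c rel_c]] :=
  nontrivial_relation (B := fun t : 'I_N => reduced_poly t) _ ltN.
  by move=> t; apply: size_reduced_poly.
(* the coefficient of B is the M-th power of that of H, and y -> y^M is an
   involution of E *)
pose H := \sum_(t < N) c t ^+ M *: digit_poly t.
have nz_H : H != 0.
  apply: (sum_size_increasing_neq0 (e := (D * q.-1)%N)) => [t|].
    exact: size_digit_poly.
  by have [t nz] := nz_c; exists t; rewrite expf_neq0.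
have szH : (size H <= (D * M + 5 * M).+1)%N.
  apply: (leq_trans (size_sum _ _ _)); apply/bigmax_leqP => t _.
  rewrite (leq_trans (size_scale_leq _ _)) // size_digit_poly ltnS.
  have : (t < M * (D + 4))%N := ltn_ord t; rewrite mulnDr.
  have : M = (D * q.-1 + D)%N by rewrite ME -mulnSr prednK // mulnC.
  by rewrite [(M * D)%N]mulnC; lia.
rewrite -ltnS; apply: leq_trans szH; rewrite cardE.
apply: max_poly_roots nz_H _ (enum_uniq _); apply/allP => x.
rewrite mem_enum inE => /andP[nz_x /eqP Tx].
suff /eqP : H.[x] ^+ M * x ^+ (D * q.-1) = 0.
  by rewrite mulf_eq0 !expf_eq0 (negPf nz_x) andbF orbF => /andP[].
have xMM (y : E) : y ^+ (M * M) = y by rewrite -expnD -oE expf_card.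
have powM : H.[x] ^+ M = \sum_(t < N) c t * (digit_poly t).[x] ^+ M.
  rewrite horner_sum (frob_iter_sum frobD) //; apply: eq_bigr => t _.
  by rewrite hornerZ exprMn -exprM xMM.
transitivity (x ^+ (M * (D * q.-1)) * (\sum_(t < N) c t *: reduced_poly t).[x]); last first.
  by rewrite rel_c horner0 mulr0.
rewrite powM horner_sum mulr_suml mulr_sumr; apply: eq_bigr => t _.
have -> : (digit_poly t).[x] = x ^+ (lo t + M * hi t) *
    (x ^+ D * half_trace x) ^+ mid t * x ^+ (D * (q.-1 - mid t)).
  by rewrite !(hornerM, hornerXn, horner_exp) horner_half_trace_poly.
have -> : (c t *: reduced_poly t).[x] = c t * (x ^+ (lo t * M + hi t) *
    (x ^+ D * half_trace x ^+ M) ^+ mid t * x ^+ (D * (q.-1 - mid t))).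
  rewrite hornerZ !(hornerM, hornerXn, horner_exp) hornerD hornerN hornerZ.
  rewrite hornerXn horner_half_trace_poly // (half_trace_frob Tx).
  by congr (_ * (_ * _ ^+ _ * _)); ring.
have := mid_lt t; move: (lo t) (mid t) (hi t) (half_trace x) => c0 e l h lt_e.
have /subnK <- : (e <= q.-1)%N by lia.
rewrite addnK; move: (q.-1 - e)%N => k.
have xl : x ^+ (M * l * M) = x ^+ l by rewrite mulnAC exprM xMM.
rewrite mulnDr !(exprMn, exprD) mulnDr !exprD -!exprM xl.
rewrite [(M * (D * k))%N]mulnC [(M * (D * e))%N]mulnC [(M * e)%N]mulnC.
by rewrite mulnA; ring.
Qed.
End Stepanov.

(** * Monic polynomials and unique factorization *)
Section MonicPolynomials.
Variable F : finFieldType.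

Definition monics n : seq {poly F} := [seq 'X^n + rVpoly c | c : 'rV[F]_n].

Lemma size_rVpoly n (c : 'rV[F]_n) : (size (rVpoly c) <= n)%N.
Proof. exact: size_poly. Qed.

Lemma mem_monics n g : (g \in monics n) = (g \is monic) && (size g == n.+1).
Proof.
apply/mapP/andP => [[c _ ->]|[mon_g /eqP szg]].
  have sz : (size (rVpoly c) < size ('X^n : {poly F}))%N.
    by rewrite size_polyXn ltnS size_rVpoly.
  by rewrite size_polyDl // size_polyXn monicE lead_coefDl // lead_coefXn.
exists (poly_rV (g - 'X^n)); first by rewrite mem_enum.
rewrite poly_rV_K; first by rewrite addrC subrK.
apply/leq_sizeP => k; rewrite leq_eqVlt => /orP[/eqP<-|lt_nk].
  rewrite coefB coefXn eqxx.
  by have /monicP := mon_g; rewrite lead_coefE szg => ->; rewrite subrr.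
by rewrite coefB coefXn gtn_eqF // subr0 nth_default // szg.
Qed.

Lemma monics_uniq n : uniq (monics n).
Proof.
rewrite map_inj_uniq ?enum_uniq // => c d /addrI eq_cd.
by rewrite -[c]rVpolyK eq_cd rVpolyK.
Qed.

Lemma exists_irreducible_factor (g : {poly F}) : (1 < size g)%N ->
  exists P, [/\ P \is monic, irreducible_poly P & P %| g].
Proof.
have [m] := ubnP (size g); elim: m g => // m IH g lt_gm sg.
have nz_g : g != 0 by rewrite -size_poly_gt0 ltnW.
have [/irreducibleP irr_g|] := boolP (irreducibleb g).
  have nz_l : (lead_coef g)^-1 != 0 by rewrite invr_eq0 lead_coef_eq0.
  exists ((lead_coef g)^-1 *: g); split; last by rewrite dvdpZl.
    by rewrite monicE lead_coefZ mulVf ?lead_coef_eq0.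
  split=> [|q sq]; first by rewrite size_scale.
  rewrite dvdpZr // => /(irr_g.2 _ sq) qg.
  by rewrite (eqp_trans qg) // eqp_sym eqp_scale.
rewrite /irreducibleb sg => /forallPn[q]; rewrite negb_imply -ltnNge.
rewrite -Pdiv.Idomain.dvdpE => /andP[q_g sq].
have lt_q : (size q < m)%N.
  rewrite (leq_ltn_trans (size_npoly q)) //; move: lt_gm sg.
  by case: (size _) => //= k; rewrite ltnS.
have [P [mP iP Pq]] := IH _ lt_q sq.
by exists P; split=> //; apply: dvdp_trans q_g.
Qed.

(** X, the only one with zero constant coefficient, is left out: [logtrace] below
    requires nonzero roots. *)
Definition irreducibles N : seq {poly F} :=
  [seq P <- [seq rVpoly c | c : 'rV[F]_N.+1]
     | [&& P \is monic, irreducibleb P & P`_0 != 0]].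

Lemma irreducibles_uniq N : uniq (irreducibles N).
Proof.
apply: filter_uniq; rewrite map_inj_uniq ?enum_uniq //.
exact: (can_inj rVpolyK).
Qed.

Lemma mem_irreducibles N P : reflect
  [/\ P \is monic, irreducible_poly P, P`_0 != 0 & (size P <= N.+1)%N]
  (P \in irreducibles N).
Proof.
rewrite mem_filter; apply: (iffP andP) => [[/and3P[mP /irreducibleP iP P0]]|].
  by case/mapP => c _ eqP; split=> //; rewrite eqP size_rVpoly.
case=> mP iP P0 sP; split; first by rewrite mP P0 andbT /=; apply/irreducibleP.
by apply/mapP; exists (poly_rV P); rewrite ?mem_enum // poly_rV_K.
Qed.

Lemma irreducible_neq_coprime (P Q : {poly F}) : P \is monic -> Q \is monic ->
  irreducible_poly P -> irreducible_poly Q -> P != Q -> coprimep P Q.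
Proof.
move=> mP mQ iP iQ nePQ; rewrite irreducible_poly_coprime //.
apply: contra nePQ => PQ; rewrite -(eqp_monic mP mQ).
by apply: iQ.2 => //; case: iP => + _; case: (size P) => [|[]].
Qed.

(** A prime P of multiplicity m in g is counted for j = 1, ..., m, with weight
    deg P each time.  The induction removes one irreducible factor P0 of g, which
    lowers the number of admissible j by one for P0 and for no other P. *)
Lemma deg_sum_irreducibles N (g : {poly F}) : g \is monic -> g`_0 != 0 ->
  (size g <= N.+1)%N ->
  (size g).-1 = (\sum_(P <- irreducibles N) \sum_(1 <= j < N.+1 | (P ^+ j %| g)%R)
                   (size P).-1)%N.
Proof.
have [m] := ubnP (size g); elim: m g => // m IH g lt_gm mg g0 sgN.
have nz_g : g != 0 by rewrite monic_neq0.
have [sg|] := ltnP 1 (size g); last first.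
  rewrite leq_eqVlt ltnS leqn0 size_poly_eq0 (negPf nz_g) orbF => /eqP sg.
  rewrite sg big_seq big1 // => P /mem_irreducibles[mP iP _ _].
  rewrite big_nat_cond big1 // => j /andP[/andP[j1 _]].
  have /size_poly1P[c nz_c ->] : size g == 1%N by rewrite sg.
  rewrite -alg_polyC dvdpZr // dvdp1 => /eqP.
  move=> s1; have /eqP := size_exp P j; rewrite s1 eq_sym muln_eq0 /=.
  by case/orP => /eqP // j0; rewrite j0 in j1.
have [P0 [mP0 iP0 P0_g]] := exists_irreducible_factor sg.
have [h def_g] : exists h : {poly F}, g = h * P0 by apply/dvdpP.
have mh : h \is monic by rewrite def_g monicMr in mg.
have sP0 : (1 < size P0)%N := iP0.1.
have nz_h : (0 < size h)%N by rewrite size_poly_gt0 monic_neq0.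
have sgE : size g = (size h + (size P0).-1)%N.
  by rewrite def_g size_Mmonic ?monic_neq0 // -(ltn_predK sP0) addnS.
have [h0 P00] : h`_0 != 0 /\ P0`_0 != 0.
  by move: g0; rewrite def_g coef0M mulf_eq0 negb_or => /andP.
have lt_hg : (size h < size g)%N.
  by rewrite sgE -addn1 leq_add2l; case: (size P0) sP0 => [|[]].
have P0irr : P0 \in irreducibles N.
  by apply/mem_irreducibles; split=> //; apply: leq_trans (dvdp_leq nz_g P0_g) _.
have lt_hm : (size h < m)%N := leq_trans lt_hg lt_gm.
have lt_hN : (size h <= N.+1)%N := ltnW (leq_trans lt_hg sgN).
have IHh := IH h lt_hm mh h0 lt_hN.
have uI := irreducibles_uniq N.
rewrite (bigD1_seq P0 P0irr uI) /= in IHh.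
rewrite (bigD1_seq P0 P0irr uI) /=.
have -> : (size g).-1 = ((size P0).-1 + (size h).-1)%N.
  by rewrite sgE; case: (size h) nz_h => // k _; rewrite addSn addnC.
rewrite IHh addnA; congr addn; last first.
  rewrite big_seq_cond [RHS]big_seq_cond; apply: eq_bigr => P.
  case/andP=> /mem_irreducibles[mP iP _ _] neP; apply: eq_bigl => j.
  by rewrite def_g Gauss_dvdpl // coprimep_expl // irreducible_neq_coprime.
have N_gt0 : (0 < N)%N by move: sg sgN; case: (N) => //; case: (size g) => [|[]].
rewrite !(big_mkcond (fun j => (P0 ^+ j %| _)%R)) [in RHS]big_ltn //.
rewrite expr1 P0_g !big_add1 /=; congr addn.
case: (N) N_gt0 sgN => // N' _ {}sgN; rewrite big_nat_recr //=.
rewrite [X in (_ + X)%N]ifN ?addn0.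
  apply: eq_bigr => j _.
  by rewrite def_g [in RHS]exprSr dvdp_mul2r // monic_neq0.
have {}lt_hN : (size h < N'.+2)%N := leq_trans lt_hg sgN.
apply: contraTN lt_hN => /dvdp_leq -/(_ (monic_neq0 mh)).
rewrite -leqNgt; apply: leq_trans.
have : (N'.+1 <= (size (P0 ^+ N'.+1)).-1)%N.
  by rewrite size_exp leq_pmull //; case: (size P0) sP0 => [|[]].
by case: (size _).
Qed.
End MonicPolynomials.

(** * The sum of a y + 1 / y over the roots of a polynomial *)
Section LogDerivative.
Variable K : fieldType.
Implicit Types (a : K) (g h : {poly K}).

(** The coefficient below the leading one, and 0 for constants: the factor X
    shifts the index so that degree 0 needs no special case. *)
Definition subleading g := ('X * g)`_(size g).-1.

(** For monic g with g(0) <> 0 this is the sum of a y + 1 / y over the roots y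
    of g, read off its coefficients so that it lies in the base field. *)
Definition logtrace a g := - (a * subleading g) - g`_1 / g`_0.

Lemma size_monic_sub_Xn g : g \is monic ->
  (size (g - 'X^((size g).-1))%R <= (size g).-1)%N.
Proof.
move=> mg; apply/leq_sizeP => k; rewrite coefB coefXn leq_eqVlt.
case/orP=> [/eqP<-|lt_k].
  by have /monicP := mg; rewrite lead_coefE => ->; rewrite eqxx subrr.
by rewrite gtn_eqF // subr0 nth_default //; case: (size g) lt_k.
Qed.

Lemma subleadingM g h : g \is monic -> h \is monic ->
  subleading (g * h) = subleading g + subleading h.
Proof.
move=> mg mh; have sg := size_monic_sub_Xn mg; have sh := size_monic_sub_Xn mh.
have nz_g := monic_neq0 mg; have nz_h := monic_neq0 mh.
rewrite /subleading size_Mmonic //; move: sg sh.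
have: (size g + size h).-1.-1 = ((size g).-1 + (size h).-1)%N.
  move: nz_g nz_h; rewrite -!size_poly_gt0.
  by case: (size g) (size h) => [|m] [|n] //= _ _; rewrite addnS.
move=> ->; move: (size g).-1 (size h).-1 => m n.
set g' := g - _; set h' := h - _ => sg sh.
have ->: 'X * (g * h) = 'X * h * 'X^m + ('X * g' * 'X^n + 'X * g' * h').
  by rewrite /g' /h'; ring.
rewrite !coefD !coefMXn ltnNge leq_addr ltnNge leq_addl /= addKn addnK.
rewrite [('X * g' * h')`_ _]nth_default ?addr0; last first.
  apply: (leq_trans (size_polyMleq _ _)); rewrite -ltnS.
  have : (size ('X * g')%R <= m.+1)%N.
    by apply: (leq_trans (size_polyMleq _ _)); rewrite size_polyX.
  by move=> /leq_add/(_ sh); case: (_ + _)%N.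
rewrite [RHS]addrC /g' mulrBr coefB -exprS coefXn.
by rewrite ltn_eqF ?subr0.
Qed.

Lemma logtrace1 a : logtrace a 1 = 0.
Proof.
rewrite /logtrace /subleading size_polyC oner_neq0 mulr1 coefX !coefC /=.
by rewrite mulr0 mul0r !oppr0 addr0.
Qed.

Lemma logtraceM a g h : g \is monic -> h \is monic -> g`_0 != 0 -> h`_0 != 0 ->
  logtrace a (g * h) = logtrace a g + logtrace a h.
Proof.
move=> mg mh g0 h0; rewrite /logtrace subleadingM // coef0M coefM.
rewrite !big_ord_recr big_ord0 /= add0r.
by field; rewrite g0 h0.
Qed.

Lemma logtraceX a g j : g \is monic -> g`_0 != 0 ->
  logtrace a (g ^+ j) = logtrace a g *+ j.
Proof.
move=> mg g0; elim: j => [|j IH]; first by rewrite expr0 logtrace1 mulr0n.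
rewrite exprS logtraceM ?monic_exp // ?IH ?mulrS //.
by rewrite -horner_coef0 horner_exp expf_neq0 // horner_coef0.
Qed.

Lemma logtraceXsubC a (y : K) : y != 0 -> logtrace a ('X - y%:P) = a * y + y^-1.
Proof.
move=> nz_y; rewrite /logtrace /subleading size_XsubC /= coefXM /= !coefB !coefX.
by rewrite !coefC /= !sub0r subr0 mulrN opprK div1r invrN opprK.
Qed.

Lemma logtrace_prod_XsubC a n (y : 'I_n -> K) : (forall i, y i != 0) ->
  logtrace a (\prod_(i < n) ('X - (y i)%:P)) = \sum_(i < n) (a * y i + (y i)^-1).
Proof.
elim: n y => [|n IH] y nz_y; first by rewrite !big_ord0 logtrace1.
rewrite !big_ord_recr /= logtraceM ?monic_prod_XsubC ?monicXsubC //.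
- by rewrite IH // logtraceXsubC.
- rewrite -horner_coef0 horner_prod; apply/prodf_neq0 => i _.
  by rewrite hornerXsubC sub0r oppr_eq0.
by rewrite coefB coefX coefC sub0r oppr_eq0.
Qed.
End LogDerivative.

Lemma map_logtrace (K L : fieldType) (f : {rmorphism K -> L}) a g :
  logtrace (f a) (map_poly f g) = f (logtrace a g).
Proof.
rewrite /logtrace /subleading size_map_poly -(map_polyX f) -rmorphM /= !coef_map.
by rewrite rmorphB rmorphN !rmorphM fmorphV.
Qed.

(** * The L-function of a Kloosterman sum *)
Section LFunction.
Variables (F : finFieldType) (C : fieldType) (phi : F -> C) (a : F).
Hypothesis phiP : nontrivial_character phi.

Definition Lcoef n : C :=
  \sum_(g <- monics F n | g`_0 != 0) phi (logtrace a g).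

Lemma Lcoef0 : Lcoef 0 = 1.
Proof.
rewrite /Lcoef (perm_big [:: 1]) => [|/=].
  rewrite big_cons big_nil coef1 oner_neq0 /= addr0 logtrace1.
  by case: phiP.
apply: uniq_perm => //; first exact: monics_uniq.
move=> g; rewrite mem_monics inE; apply/andP/eqP => [[mg /eqP sg]|->].
  rewrite [g]size1_polyC ?sg //; congr _%:P.
  by have /monicP := mg; rewrite lead_coefE sg.
by rewrite monic1 size_polyC oner_neq0.
Qed.

Lemma Lcoef1 : Lcoef 1 = kloosterman_sum phi a.
Proof.
rewrite /Lcoef (perm_big [seq 'X - y%:P | y : F]) => [|/=].
  rewrite big_map big_enum_cond /=.
  have coef0E (y : F) : (('X - y%:P)`_0 != 0) = (y != 0).
    by rewrite coefB coefX coefC sub0r oppr_eq0.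
  by apply: eq_big => // y; rewrite coef0E => nz_y; rewrite logtraceXsubC.
apply: uniq_perm; first exact: monics_uniq.
  rewrite map_inj_uniq ?enum_uniq // => x y /addrI/oppr_inj.
  exact: polyC_inj.
move=> g; rewrite mem_monics; apply/andP/mapP => [[mg /eqP sg]|[y _ ->]].
  exists (- g`_0); rewrite ?mem_enum // polyCN opprK; apply/polyP => k.
  rewrite coefD coefX coefC; case: k => [|[|k]] /=; rewrite ?add0r ?addr0 //.
    by have /monicP := mg; rewrite lead_coefE sg.
  by rewrite nth_default ?sg.
by rewrite monicXsubC size_XsubC.
Qed.

(** For g = X^2 + c2 X + c1 the value is phi (- (a + 1 / c1) c2); the sum over c2
    selects c1 = - 1 / a. *)
Lemma Lcoef2 : a != 0 -> Lcoef 2 = #|F|%:R.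
Proof.
move=> nz_a.
pose quad (c : F * F) : {poly F} := 'X^2 + c.2 *: 'X + c.1%:P.
have quadE c : ((quad c)`_0 = c.1) * ((quad c)`_1 = c.2) * ((quad c)`_2 = 1)
     * (forall k, (quad c)`_k.+3 = 0).
  by do ![split|move=> k]; rewrite /quad !coefD coefXn coefZ coefX coefC /=; ring.
have size_quad c : size (quad c) = 3.
  apply/eqP; rewrite eqn_leq; apply/andP; split.
    by apply/leq_sizeP => -[|[|[|k]]] // _; rewrite quadE.
  by rewrite ltnNge; apply/negP => /leq_sizeP/(_ 2%N (leqnn _))/eqP;
    rewrite quadE oner_eq0.
rewrite /Lcoef (perm_big [seq quad c | c : F * F]) => [|/=].
  rewrite big_map big_enum_cond /=.
  transitivity (\sum_(c : F * F | (c.1 != 0) && true)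
                   phi (- (a + c.1^-1) * c.2)).
    apply: eq_big => [c|c _]; first by rewrite quadE andbT.
    rewrite /logtrace /subleading size_quad coefXM /= !quadE; congr phi.
    by rewrite [c.2 / _]mulrC; ring.
  rewrite -(pair_big_dep (fun x => x != 0) (fun _ _ => true)
     (fun x y => phi (- (a + x^-1) * y))) /=.
  under eq_bigr do rewrite sum_character_scale //.
  have nz_x : - a^-1 != 0 by rewrite oppr_eq0 invr_eq0.
  rewrite (bigD1 (- a^-1)) //= invrN invrK subrr oppr0 eqxx.
  rewrite big1 ?addr0 // => x /andP[nz_x' nex].
  rewrite oppr_eq0 addr_eq0 ifN //; apply: contra nex => /eqP->.
  by rewrite invrN invrK opprK.
apply: uniq_perm; first exact: monics_uniq.
  rewrite map_inj_uniq ?enum_uniq // => -[x1 y1] [x2 y2] eq_q.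
  have := congr1 (fun p : {poly F} => p`_0) eq_q.
  have := congr1 (fun p : {poly F} => p`_1) eq_q.
  by rewrite !quadE /= => -> ->.
move=> g; rewrite mem_monics; apply/andP/mapP => [[mg /eqP sg]|[c _ ->]].
  exists (g`_0, g`_1); rewrite ?mem_enum //; apply/polyP => -[|[|[|k]]];
   rewrite quadE //.
    by have /monicP := mg; rewrite lead_coefE sg.
  by rewrite nth_default ?sg.
by rewrite size_quad monicE lead_coefE size_quad quadE.
Qed.

(** In degree n >= 3 the coefficient of X^(n-1) varies independently of the two
    lowest ones, and shifting it multiplies the summand by a value of phi that can
    be made different from 1. *)
Lemma Lcoef_eq0 n : a != 0 -> (2 < n)%N -> Lcoef n = 0.
Proof.
move=> nz_a; case: n => [|[|[|n]]] // _.
have [_ phiD [t ne1]] := phiP.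
set n' := n.+3; pose tn : 'I_n' := Ordinal (ltnSn n.+2).
pose d : 'rV[F]_n' := (- a^-1 * t) *: delta_mx 0 tn.
have dE : rVpoly d = (- a^-1 * t) *: 'X^(n.+2).
  by rewrite linearZ /= rVpoly_delta.
have szg (c : 'rV[F]_n') : size ('X^n' + rVpoly c) = n'.+1.
  by rewrite size_polyDl size_polyXn // ltnS size_rVpoly.
have shift (c : 'rV[F]_n') :
  logtrace a ('X^n' + rVpoly (c + d)) = t + logtrace a ('X^n' + rVpoly c).
  rewrite /logtrace /subleading !szg /= !coefXM /= linearD /= dE !coefD !coefZ.
  rewrite !coefXn eqxx /= !mulr0 !addr0 mulr1 !mulrDr mulrA mulrN mulfV // mulN1r.
  by ring.
apply/eqP; have : (1 - phi t) * Lcoef n' == 0.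
  rewrite /Lcoef big_map big_enum_cond /= mulrBl mul1r subr_eq0 mulr_sumr.
  rewrite [X in X == _](reindex_inj (addIr d)) /=; apply/eqP.
  apply: eq_big => [c|c _]; last by rewrite shift phiD.
  by rewrite linearD /= dE !coefD coefZ !coefXn /= mulr0 !add0r addr0.
by rewrite mulf_eq0 subr_eq0 eq_sym (negPf ne1).
Qed.
End LFunction.

(** * Newton identities *)
Section Newton.
Variables (F : finFieldType) (C : fieldType) (phi : F -> C) (a : F).
Hypothesis phiP : nontrivial_character phi.
Local Notation deg P := (size P).-1.

(** The coefficient of T^r in the logarithmic derivative T L'(T) / L(T) of the
    L-function, as given by its Euler product; for 0 < r <= N it is independent of N. *)
Definition power_sum N r : C :=
  \sum_(P <- irreducibles F N | (deg P %| r)%N)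
     (deg P)%:R * phi (logtrace a P *+ (r %/ deg P)).

Lemma Lcoef_multiples n (Q : {poly F}) : Q \is monic -> Q`_0 != 0 ->
  \sum_(g <- monics F n | (g`_0 != 0) && (Q %| g)) phi (logtrace a g) =
  if (deg Q <= n)%N then phi (logtrace a Q) * Lcoef phi a (n - deg Q) else 0.
Proof.
move=> mQ Q0; have [_ phiD _] := phiP; have nz_Q := monic_neq0 mQ.
case: leqP => [le_Q|lt_Q]; last first.
  rewrite big_seq_cond big1 // => g /and3P[]; rewrite mem_monics => /andP[mg /eqP sg] _.
  move=> /dvdp_leq -/(_ (monic_neq0 mg)); rewrite sg.
  by case: (size Q) lt_Q => //= k lt_k; rewrite ltnS leqNgt lt_k.
rewrite -big_filter (perm_big (map (fun h => Q * h)
    [seq h : {poly F} <- monics F (n - deg Q) | h`_0 != 0])).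
  rewrite big_map big_filter mulr_sumr big_seq_cond [RHS]big_seq_cond.
  apply: eq_bigr => h /andP[]; rewrite mem_monics => /andP[mh _] h0.
  by rewrite logtraceM.
have mulQI : injective (fun h => Q * h) by apply: mulfI.
apply: uniq_perm; first by rewrite filter_uniq ?monics_uniq.
  by rewrite map_inj_uniq // filter_uniq ?monics_uniq.
move=> g; rewrite mem_filter mem_monics; apply/idP/mapP.
  case/and3P=> /andP[g0 Qg] mg /eqP sg.
  have [h def_g] : exists h : {poly F}, g = h * Q by apply/dvdpP.
  exists h; last by rewrite mulrC.
  have mh : h \is monic by rewrite def_g monicMr in mg.
  have := g0; rewrite def_g coef0M mulf_eq0 negb_or => /andP[h0 _].
  rewrite mem_filter h0 mem_monics mh /=.
  move: sg; rewrite def_g size_Mmonic ?monic_neq0 //.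
  have : (0 < size Q)%N by rewrite size_poly_gt0.
  have : (0 < size h)%N by rewrite size_poly_gt0 monic_neq0.
  move: le_Q; case: (size Q) (size h) => [|k] [|l] //=; rewrite addnS /= => le_k _ _ [<-].
  by rewrite addnK.
case=> h; rewrite mem_filter mem_monics => /and3P[h0 mh /eqP sh] ->.
rewrite coef0M mulf_neq0 // dvdp_mulr // monicMl // mh /=.
rewrite size_Mmonic // sh.
move: nz_Q le_Q; rewrite -size_poly_gt0; case: (size Q) => // k _ /= le_k.
by rewrite addnS subnKC.
Qed.

(** The degree n of g is the sum of deg P over the prime powers P^j dividing g
    ([deg_sum_irreducibles]).  Exchanging the sums over g and over P^j, and
    writing g = P^j h, gives the products of the right hand side. *)
Lemma newton_identity N n : (n <= N)%N ->
  n%:R * Lcoef phi a n = \sum_(1 <= r < n.+1) power_sum N r * Lcoef phi a (n - r).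
Proof.
move=> le_nN.
transitivity (\sum_(P <- irreducibles F N) \sum_(1 <= j < N.+1)
   \sum_(1 <= r < n.+1 | r == (j * deg P)%N)
   (deg P)%:R * phi (logtrace a P *+ j) * Lcoef phi a (n - r)).
  transitivity (\sum_(P <- irreducibles F N) \sum_(1 <= j < N.+1)
     \sum_(g <- monics F n | (g`_0 != 0) && (P ^+ j %| g))
       (deg P)%:R * phi (logtrace a g)).
    rewrite /Lcoef mulr_sumr.
    under [RHS]eq_bigr do under eq_bigr do rewrite big_mkcondr.
    under [RHS]eq_bigr do rewrite exchange_big.
    rewrite exchange_big; rewrite big_seq_cond [RHS]big_seq_cond.
    apply: eq_bigr => g /andP[]; rewrite mem_monics => /andP[mg /eqP sg] g0.
    have szN : (size g <= N.+1)%N by rewrite sg.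
    have := deg_sum_irreducibles mg g0 szN; rewrite sg /= => {1}->.
    rewrite natr_sum mulr_suml; apply: eq_bigr => P _.
    rewrite natr_sum mulr_suml big_mkcond; apply: eq_bigr => j _.
    by case: ifP.
  rewrite big_seq_cond [RHS]big_seq_cond; apply: eq_bigr => P /andP[].
  case/mem_irreducibles=> mP iP P0 sP _.
  rewrite big_nat_cond [RHS]big_nat_cond; apply: eq_bigr => j /andP[/andP[j1 _] _].
  rewrite -mulr_sumr Lcoef_multiples ?monic_exp //; last first.
    by rewrite -horner_coef0 horner_exp expf_neq0 // horner_coef0.
  rewrite size_exp logtraceX // mulnC; case: leqP => [le_n|lt_n].
    rewrite big_nat1_eq ltnS le_n andbT muln_gt0 j1 ifT ?mulrA //.
    by case: iP => + _; case: (size P) => [|[]].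
  rewrite mulr0 big_nat_cond big1 // => r /andP[/andP[_ +] /eqP def_r].
  by rewrite def_r ltnS leqNgt lt_n.
transitivity (\sum_(P <- irreducibles F N) \sum_(1 <= r < n.+1 | (deg P %| r)%N)
   (deg P)%:R * phi (logtrace a P *+ (r %/ deg P)) * Lcoef phi a (n - r)).
  rewrite big_seq_cond [RHS]big_seq_cond; apply: eq_bigr => P /andP[].
  case/mem_irreducibles=> mP iP P0 sP _.
  have d_gt0 : (0 < deg P)%N by case: iP => + _; case: (size P) => [|[]].
  rewrite (exchange_big_dep_nat xpredT) //= [RHS]big_mkcond.
  rewrite big_nat_cond [RHS]big_nat_cond; apply: eq_bigr => r.
  case/andP=> /andP[r1 r_n] _; case: ifP => [/dvdnP[j def_r]|ndv].
    rewrite (eq_bigl (fun i => i == j)) => [|i]; last first.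
      by rewrite def_r eqn_pmul2r // eq_sym.
    rewrite big_nat1_eq def_r mulnK // ifT //.
    move: r1 r_n; rewrite def_r muln_gt0 !ltnS => /andP[-> _] r_n /=.
    by rewrite (leq_trans _ le_nN) // (leq_trans _ r_n) // leq_pmulr.
  rewrite big_pred0 // => j; apply: contraFF ndv => /eqP->.
  exact: dvdn_mull.
under eq_bigr do rewrite big_mkcond.
rewrite exchange_big; apply: eq_bigr => r _.
rewrite /power_sum mulr_suml [RHS]big_mkcond.
by apply: eq_bigr => P _; case: ifP.
Qed.
End Newton.

(** * Power sums as Kloosterman sums over extension fields *)

(** The class of X in the field F[X] / P, of order q^(deg P), is fixed by the
    q^(deg P)-th power map. *)
Lemma dvd_Xexp_sub_X (F : finFieldType) (P : {poly F}) k :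
  P \is monic -> irreducible_poly P -> ((size P).-1 %| k)%N ->
  P %| 'X^(#|F| ^ k) - 'X.
Proof.
move=> mP iP /dvdnP[j ->].
have mi : monic_irreducible_poly P by [].
pose x : {poly %/ P with mi} := in_qpoly P 'X.
have xq : x ^+ (#|F| ^ (j * (size P).-1)) = x.
  rewrite mulnC expnM -(card_qfpoly mi).
  by elim: j => [|j IH]; rewrite ?expn0 ?expr1 // expnSr exprM IH expf_card.
have : in_qpoly P ('X^(#|F| ^ (j * (size P).-1)) - 'X) = 0.
  by rewrite rmorphB rmorphXn /=; apply/eqP; rewrite subr_eq0; apply/eqP.
move=> /(congr1 val) /= /eqP.
by rewrite -Pdiv.IdomainMonic.modpE ?monic_mk_monic // mk_monicE.
Qed.

Section Extension.
Variables (F E : finFieldType) (iota : {rmorphism F -> E}).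
Local Notation q := #|F|.
Local Notation "p ^iota" := (map_poly iota p) (at level 2, format "p ^iota").

Lemma frobenius_additive (x y : E) : (x + y) ^+ q = x ^+ q + y ^+ q.
Proof.
have [p pr_p pcharF] := finPcharP F.
rewrite (card_pprimeChar pcharF); apply: exprDn_pchar.
rewrite pnatX; apply/orP; left; rewrite pnatE //.
exact: (rmorph_pchar iota).
Qed.

Lemma card_base_gt1 : (1 < q)%N. Proof. exact: finNzRing_gt1. Qed.
Let q_gt0 : (0 < q)%N. Proof. exact: ltnW card_base_gt1. Qed.

Lemma frobenius_iota i b : iota b ^+ (q ^ i) = iota b.
Proof.
by elim: i => [|i IH]; rewrite ?expr1 // expnSr exprM IH -rmorphXn expf_card.
Qed.

Lemma frobenius_fixedP (z : E) : z ^+ q = z -> exists b, z = iota b.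
Proof.
move=> zq; have : root ('X^q - 'X)^iota z.
  by rewrite rmorphB /= map_polyXn map_polyX rootE !hornerE zq subrr.
rewrite finField_genPoly rmorph_prod /= -big_enum /=.
have -> : \prod_(b <- enum F) ('X - b%:P)^iota = \prod_(z <- map iota (enum F)) ('X - z%:P).
  by rewrite big_map; apply: eq_bigr => b _; rewrite map_polyXsubC.
by rewrite root_prod_XsubC => /mapP[b _ ->]; exists b.
Qed.

Definition frobenius (x : E) := x ^+ q.
Lemma frobenius_zmod : zmod_morphism frobenius.
Proof.
move=> x y; apply/eqP; rewrite eq_sym subr_eq /frobenius.
by rewrite -frobenius_additive subrK.
Qed.
Lemma frobenius_monoid : monoid_morphism frobenius.
Proof. by split=> [|x y]; rewrite /frobenius ?expr1n ?exprMn. Qed.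
HB.instance Definition _ := GRing.isZmodMorphism.Build E E frobenius frobenius_zmod.
HB.instance Definition _ := GRing.isMonoidMorphism.Build E E frobenius frobenius_monoid.

Lemma poly_descent (f : {poly E}) : map_poly frobenius f = f ->
  exists g : {poly F}, f = g^iota.
Proof.
move=> fixf.
have /fin_all_exists[c cE] (i : 'I_(size f)) : exists b, f`_i = iota b.
  by apply: frobenius_fixedP; rewrite -[LHS]/(frobenius _) -coef_map fixf.
exists (\sum_(i < size f) c i *: 'X^i).
rewrite rmorph_sum -[LHS]coefK poly_def; apply: eq_bigr => i _.
by rewrite cE /= map_polyZ map_polyXn.
Qed.

Lemma horner_frobenius (g : {poly F}) (x : E) i :
  g^iota.[x ^+ (q ^ i)] = g^iota.[x] ^+ (q ^ i).
Proof.
rewrite !horner_coef (frob_iter_sum frobenius_additive) //.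
apply: eq_bigr => j _.
by rewrite exprMn coef_map /= frobenius_iota -!exprM mulnC.
Qed.

Variable k : nat.
Hypotheses (k_gt0 : (0 < k)%N) (oE : #|E| = (q ^ k)%N).

Definition norm_poly (x : E) := \prod_(i < k) ('X - (x ^+ (q ^ i))%:P).

Lemma norm_poly_descent x : exists g : {poly F}, norm_poly x = g^iota.
Proof.
apply: poly_descent; rewrite /norm_poly rmorph_prod /=.
pose h i := 'X - (x ^+ (q ^ i))%:P.
transitivity (\prod_(i < k) h i.+1).
  apply: eq_bigr => i _; rewrite map_polyXsubC /= /frobenius /h.
  by rewrite -exprM -expnSr.
rewrite -[LHS](big_mkord xpredT (fun i => h i.+1)) -[RHS](big_mkord xpredT h).
rewrite -(big_add1 _ _ 0 k.+1 xpredT h) big_nat_recr //= [RHS]big_ltn // mulrC.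
by congr (_ * _); rewrite /h -oE expf_card expr1.
Qed.

Lemma irreducible_common_root (P Q : {poly F}) (x : E) : P \is monic -> Q \is monic ->
  irreducible_poly P -> irreducible_poly Q -> root P^iota x -> root Q^iota x -> P = Q.
Proof.
move=> mP mQ iP iQ Px Qx; apply/eqP; apply: contraLR Qx => nePQ.
have := irreducible_neq_coprime mP mQ iP iQ nePQ.
by rewrite -(coprimep_map iota) => /coprimep_root/(_ Px).
Qed.

(** All roots of the norm polynomial of x are conjugates of x, so x is a root of
    every irreducible factor; but two irreducible monic polynomials with a common
    root are equal. *)
Lemma norm_poly_power x (g : {poly F}) : norm_poly x = g^iota ->
  exists P j, [/\ P \is monic, irreducible_poly P, root P^iota x & g = P ^+ j].
Proof.
move=> def_g.
have mg : g \is monic by rewrite -(map_monic iota) -def_g monic_prod_XsubC.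
have szg : size g = k.+1.
  by rewrite -(size_map_poly iota) -def_g size_prod_XsubC /index_enum -enumT size_enum_ord.
have rootN (Q : {poly F}) : Q %| g -> Q \is monic -> irreducible_poly Q ->
    root Q^iota x.
  move=> Qg mQ iQ; have : Q^iota %| norm_poly x by rewrite def_g dvdp_map.
  case/dvdp_prod_XsubC => m; set r := mask _ _ => Qm.
  have : (0 < size r)%N.
    move: (eqp_size Qm); rewrite size_map_poly size_prod_XsubC => szQ.
    by rewrite -ltnS -szQ; case: iQ.
  case def_r : r => [|i r'] // _; have : root Q^iota (x ^+ (q ^ i)).
    by rewrite (eqp_root Qm) def_r big_cons rootM root_XsubC eqxx.
  by rewrite rootE horner_frobenius expf_eq0 => /andP[].
have [P [mP iP Pg]] : exists P, [/\ P \is monic, irreducible_poly P & P %| g].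
  by apply: exists_irreducible_factor; rewrite szg.
have Px := rootN P Pg mP iP.
suff [j gE] : exists j, g = P ^+ j by exists P, j; split.
suff divisors n (R : {poly F}) : R \is monic -> (size R < n)%N -> R %| g ->
    exists j, R = P ^+ j.
  exact: divisors mg (ltnSn _) (dvdpp g).
elim: n R => // n IH R mR le_R R_g.
have nz_R := monic_neq0 mR.
have [s1|s1] := leqP (size R) 1.
  exists 0%N; rewrite expr0; apply/eqP; rewrite -(eqp_monic mR (monic1 F)).
  by rewrite -size_poly_eq1 eqn_leq size_poly_gt0 nz_R andbT.
have [P1 [mP1 iP1 P1R]] := exists_irreducible_factor s1.
have P1E : P1 = P.
  apply: irreducible_common_root (rootN P1 _ _ _) Px => //.
  exact: dvdp_trans P1R R_g.
have [R' def_R] : exists R' : {poly F}, R = R' * P by apply/dvdpP; rewrite -P1E.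
have mR' : R' \is monic by rewrite def_R monicMr in mR.
have [||j R'E] := IH R' mR'; last by exists j.+1; rewrite def_R R'E exprSr.
  move: le_R; rewrite def_R size_Mmonic ?monic_neq0 //.
  have := iP.1; case: (size P) => [|[|l]] // _; rewrite !addnS /= ltnS => le_R.
  by apply: leq_ltn_trans le_R; rewrite leq_addr.
by apply: dvdp_trans R_g; rewrite def_R dvdp_mulr.
Qed.

Local Notation deg P := (size P).-1.
Variable a : F.
Definition ext_trace (x : E) := \sum_(i < k) laurent (iota a) x ^+ (q ^ i).

Lemma ext_trace_norm x (g : {poly F}) : x != 0 -> norm_poly x = g^iota ->
  g`_0 != 0 /\ ext_trace x = iota (logtrace a g).
Proof.
move=> nz_x def_g; have nz_xi i : x ^+ (q ^ i) != 0 by rewrite expf_neq0.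
split.
  rewrite -(fmorph_eq0 iota) -coef_map -def_g -horner_coef0 horner_prod.
  by apply/prodf_neq0 => i _; rewrite hornerXsubC sub0r oppr_eq0.
rewrite -map_logtrace -def_g logtrace_prod_XsubC //; apply: eq_bigr => i _.
by rewrite /laurent (frob_iterD frobenius_additive) exprMn frobenius_iota exprVn.
Qed.

(** The minimal polynomial P of x: the norm polynomial of x is P^(k / deg P), and
    comparing [logtrace] on both sides computes the trace of a x + 1 / x. *)
Lemma minimal_irreducible N x : (k <= N)%N -> x != 0 ->
  exists P, [/\ P \in irreducibles F N, (deg P %| k)%N, root P^iota x
    & ext_trace x = iota (logtrace a P *+ (k %/ deg P))].
Proof.
move=> le_kN nz_x; have [g def_g] := norm_poly_descent x.
have [g0 ->] := ext_trace_norm nz_x def_g.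
have [P [j [mP iP Px gE]]] := norm_poly_power def_g.
have szg : size g = k.+1.
  by rewrite -(size_map_poly iota) -def_g size_prod_XsubC /index_enum -enumT size_enum_ord.
have kE : k = (deg P * j)%N by rewrite -size_exp -gE szg.
have [d_gt0 j_gt0] : (0 < deg P)%N /\ (0 < j)%N.
  by apply/andP; rewrite -muln_gt0 -kE.
have P0 : P`_0 != 0.
  move: g0; rewrite gE -!horner_coef0 horner_exp expf_eq0 j_gt0.
  by [].
exists P; split=> //; last by rewrite gE logtraceX // kE mulKn.
  apply/mem_irreducibles; split=> //.
  apply: (leq_trans (leqSpred _)); rewrite ltnS (leq_trans _ le_kN) //.
  by rewrite kE leq_pmulr.
by rewrite kE dvdn_mulr.
Qed.

Lemma card_roots_irreducible (P : {poly F}) : P \is monic -> irreducible_poly P ->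
  (deg P %| k)%N -> #|[pred x | root P^iota x]| = deg P.
Proof.
move=> mP iP dk; have := dvd_Xexp_sub_X mP iP dk.
rewrite -(dvdp_map iota) rmorphB /= map_polyXn map_polyX -oE finField_genPoly.
rewrite -big_enum => /dvdp_prod_XsubC[m eqP].
have := eqp_size eqP; rewrite size_map_poly size_prod_XsubC => -> /=.
rewrite -(card_uniqP (mask_uniq (enum_uniq E) m)); apply: eq_card => x.
by rewrite inE (eqp_root eqP) root_prod_XsubC.
Qed.

(** Grouping the elements x <> 0 of E by their minimal polynomial P: there are
    deg P of them for each P whose degree divides k.  The sum of phi over the
    traces is then written by the values b of the trace. *)
Lemma power_sum_fibers (C : fieldType) (phi : F -> C) N : (k <= N)%N ->
  power_sum phi a N k =
  \sum_b phi b *+ #|[set x | (x != 0) && (ext_trace x == iota b)]|.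
Proof.
move=> le_kN.
transitivity (\sum_(P <- irreducibles F N | (deg P %| k)%N) \sum_(x : E | root P^iota x)
   phi (logtrace a P *+ (k %/ deg P))).
  rewrite /power_sum big_seq_cond [RHS]big_seq_cond; apply: eq_bigr => P.
  case/andP=> /mem_irreducibles[mP iP _ _] dk.
  by rewrite sumr_const card_roots_irreducible // mulr_natl.
rewrite big_seq_cond (exchange_big_dep (fun x : E => x != 0)) /=; last first.
  move=> P x /andP[/mem_irreducibles[_ _ P0 _] _]; apply: contraTneq => ->.
  by rewrite rootE horner_coef0 coef_map fmorph_eq0.
transitivity (\sum_(x : E | x != 0) \sum_(b | ext_trace x == iota b) phi b); last first.
  rewrite (exchange_big_dep xpredT) //=; apply: eq_bigr => b _.
  by rewrite sumr_const; congr (_ *+ _); apply: eq_card => x; rewrite !inE.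
apply: eq_bigr => x nz_x.
have [P [P_irr dP Px ->]] := minimal_irreducible le_kN nz_x.
have [mP iP _ _] := mem_irreducibles _ _ P_irr.
rewrite (big_pred1 (logtrace a P *+ (k %/ deg P))) => [|b]; last first.
  by rewrite (inj_eq (fmorph_inj iota)) eq_sym.
rewrite -big_filter (_ : filter _ _ = [:: P]) ?big_seq1 //.
rewrite -(filter_pred1_uniq (irreducibles_uniq F N) P_irr).
apply: eq_in_filter => Q /mem_irreducibles[mQ iQ _ _] /=.
apply/andP/eqP => [[_ Qx]|->]; last by rewrite P_irr dP.
exact: irreducible_common_root Qx Px.
Qed.
End Extension.

(** In a splitting field of X^Q - X, with Q = q^k, the roots form the subfield
    fixed by the k-th power of the Frobenius, hence the whole field; there are Q
    of them because the derivative of X^Q - X is - 1. *)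
Lemma finField_extension (F : finFieldType) k : (0 < k)%N ->
  exists (E : finFieldType) (iota : {rmorphism F -> E}), #|E| = (#|F| ^ k)%N.
Proof.
move=> k_gt0; set Q := (#|F| ^ k)%N.
have q_gt1 : (1 < #|F|)%N := finNzRing_gt1 F.
have Q_gt1 : (1 < Q)%N by rewrite -(exp1n k) ltn_exp2r.
have szQ (K : nzRingType) : size ('X^Q - 'X : {poly K}) = Q.+1.
  by rewrite size_polyDl size_polyXn // size_polyN size_polyX.
have nzQ : 'X^Q - 'X != 0 :> {poly F} by rewrite -size_poly_eq0 szQ.
have [L [zs Dzs defL]] := FinSplittingFieldFor nzQ.
rewrite rmorphB /= map_polyXn map_polyX in Dzs.
have Q0 : Q%:R = 0 :> L.
  have [p pr_p pcharF] := finPcharP F.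
  have pcharL : p \in [pchar L] by rewrite pchar_lalg.
  apply/eqP; rewrite -(dvdn_pcharf pcharL) /Q dvdn_exp //.
  have cF : #|F| = (p ^ logn p #|F|)%N := card_pprimeChar pcharF.
  by move: q_gt1; rewrite cF; case: (logn _ _) => [|m]; rewrite ?expnS ?dvdn_mulr.
have Uzs : uniq zs.
  rewrite -separable_prod_XsubC -(eqp_separable Dzs) unlock.
  rewrite derivB derivXn derivX -mulr_natl -polyC_natr Q0 mul0r sub0r.
  by rewrite -[X in coprimep _ X]scaleN1r coprimepZr ?coprimep1 // oppr_eq0 oner_eq0.
have in_zs z : (z \in zs) = (z ^+ Q == z).
  rewrite -root_prod_XsubC -(eqp_root Dzs) rootE !hornerE subr_eq0.
  by [].
have size_zs : size zs = Q.
  by apply: succn_inj; rewrite -(size_prod_XsubC _ id) -(eqp_size Dzs) szQ.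
exists (FinFieldExtType L), (in_alg L).
have card_zs := (@card_uniqP (FinFieldExtType L) zs) Uzs.
rewrite -size_zs -card_zs; apply: eq_card => x; rewrite inE.
have [f _ Df] := finField_galois_generator (sub1v {:L}).
have fk z : (f ^+ k)%g z = z ^+ Q.
  rewrite /Q; elim: (k) => [|i IH]; first by rewrite expr1 gal_id.
  by rewrite expgSr galM ?memvf // IH Df ?memvf //= dimv1 expn1 -exprM -expnSr.
have : x \in fixedSpace (f ^+ k)%g.
  suff -> : fixedSpace (f ^+ k)%g = {:L}%VS by rewrite memvf.
  apply/eqP; rewrite eqEsubv subvf -defL -[fixedSpace _]subfield_closed agenvS //.
  rewrite subv_add sub1v; apply/span_subvP => z; rewrite in_zs => /eqP zQ.
  by apply/fixedSpaceP; rewrite fk.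
by move/fixedSpaceP; rewrite fk in_zs => /eqP.
Qed.

(** * Weil's bound *)

(** The Newton identities determine the power sums from the L-function
    1 + K T + q T^2 = (1 - b1 T) (1 - b2 T). *)
Lemma power_sum_two_roots (F : finFieldType) (C : fieldType) (phi : F -> C) (a : F)
    N (b1 b2 : C) :
  nontrivial_character phi -> a != 0 ->
  b1 + b2 = - kloosterman_sum phi a -> b1 * b2 = #|F|%:R ->
  forall r, (0 < r <= N)%N -> power_sum phi a N r = - (b1 ^+ r + b2 ^+ r).
Proof.
move=> phiP nz_a sumb prodb r.
have K_E : kloosterman_sum phi a = - (b1 + b2) by rewrite sumb opprK.
have := @newton_identity F C phi a phiP N; move: (power_sum _ _ _) => s newton.
elim/ltn_ind: r => -[|[|[|r]]] IH //= le_rN.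
- have := newton 1%N le_rN; rewrite big_nat1 subnn Lcoef0 // Lcoef1 // mul1r mulr1 => <-.
  by rewrite K_E !expr1.
- have := newton 2%N le_rN; rewrite big_nat_recr //= big_nat1 subnn.
  rewrite Lcoef0 // Lcoef1 // Lcoef2 //.
  rewrite (IH 1%N) ?(ltnW le_rN) // mulr1 K_E -prodb !expr1 => eq2.
  have -> : s 2%N = 2%:R * (b1 * b2) - - (b1 + b2) * - (b1 + b2).
    by rewrite eq2 addrAC subrr add0r.
  by ring.
have := newton r.+3 le_rN; rewrite Lcoef_eq0 // mulr0.
rewrite big_nat_recr //= big_nat_recr //= big_nat_recr //= big_nat_cond big1; last first.
  move=> i /andP[/andP[i1 lti] _]; rewrite Lcoef_eq0 ?mulr0 //.
  by lia.
have -> : (r.+3 - r.+1 = 2)%N by lia.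
have -> : (r.+3 - r.+2 = 1)%N by lia.
rewrite subnn.
rewrite Lcoef0 // Lcoef1 // Lcoef2 //.
have le1 : (r.+1 <= N)%N by lia.
have le2 : (r.+2 <= N)%N by lia.
rewrite (IH r.+1) ?(IH r.+2) //; try lia; rewrite K_E -prodb mulr1 add0r => /eqP.
rewrite eq_sym addrC addr_eq0 => /eqP ->.
by rewrite !exprS; ring.
Qed.

Section CharacterBound.
Variables (F : finFieldType) (C : numFieldType) (phi : F -> C) (a : F).
Hypotheses (phiP : nontrivial_character phi) (phi_norm : forall x, `|phi x| = 1).
Local Notation q := #|F|.

(** With n_b the number of x whose trace is b, and B the bound of
    [stepanov_bound] for all n_b, the sum of phi b n_b is minus the sum of
    phi b (B - n_b), because the phi b add up to 0.  As B - n_b >= 0, this is at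
    most q B minus the sum of the n_b, and the latter is q^(2j+2) - 1: the main
    term q^(2j+2) of q B cancels. *)
Lemma power_sum_even_bound N j : a != 0 -> (j.+1 + j.+1 <= N)%N ->
  `|power_sum phi a N (j.+1 + j.+1)| <= (6 * q * q ^ j.+1)%:R.
Proof.
move=> nz_a le_N; set k := (j.+1 + j.+1)%N in le_N *.
have k_gt0 : (0 < k)%N by [].
have [E [iota oE]] := finField_extension F k_gt0.
pose n b := #|[set x : E | (x != 0) && (ext_trace iota k a x == iota b)]|.
have -> : power_sum phi a N k = \sum_b phi b *+ n b.
  exact: power_sum_fibers.
pose B := (q ^ j * q ^ j.+1 + 5 * q ^ j.+1)%N.
have q_gt1 : (1 < q)%N := finNzRing_gt1 F.
have le_n b : (n b <= B)%N.
  apply: (@stepanov_bound E q j (iota a) (iota b)) => //.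
    exact: frobenius_additive iota.
  by rewrite fmorph_eq0.
have sum_n : (\sum_b n b = q * (q ^ j * q ^ j.+1) - 1)%N.
  transitivity (\sum_(x : E | x != 0%R) 1)%N; last first.
    rewrite sum1_card (_ : #|_| = #|predC1 (0 : E)|); last exact: eq_card.
    by rewrite cardC1 oE -subn1 mulnA -expnS -expnD.
  transitivity (\sum_(x : E | x != 0%R) \sum_(b | ext_trace iota k a x == iota b) 1)%N.
    rewrite (exchange_big_dep xpredT) //=; apply: eq_bigr => b _.
    by rewrite sum1_card; apply: eq_card => x; rewrite !inE.
  apply: eq_bigr => x nz_x.
  have [P [_ _ _ ->]] := minimal_irreducible iota k_gt0 oE a (leqnn k) nz_x.
  rewrite (big_pred1 (logtrace a P *+ (k %/ (size P).-1))) // => b.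
  by rewrite (inj_eq (fmorph_inj iota)) eq_sym.
have -> : \sum_b phi b *+ n b = - \sum_b phi b *+ (B - n b).
  apply/eqP; rewrite -addr_eq0 -big_split /=.
  under eq_bigr do rewrite -mulrnDr subnKC //.
  by rewrite sumrMnl (sum_character phiP) mul0rn.
rewrite normrN; apply: (le_trans (ler_norm_sum _ _ _)).
under eq_bigr do rewrite normrMn phi_norm.
rewrite -natr_sum ler_nat.
have : (\sum_b (B - n b) + \sum_b n b = q * B)%N.
  rewrite -big_split /=; under eq_bigr do rewrite subnK //.
  by rewrite sum_nat_const.
rewrite sum_n /B expnS => eqS.
have : (0 < q ^ j)%N by rewrite expn_gt0 ltnW.
move=> D_gt0; have X_gt0 : (0 < q * (q ^ j * (q * q ^ j)))%N.
  by rewrite !muln_gt0 D_gt0 ltnW.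
have Y_gt0 : (0 < q * (q * q ^ j))%N by rewrite !muln_gt0 D_gt0 ltnW.
move: eqS; rewrite mulnDr [(q * (5 * _))%N]mulnCA -[(6 * q * _)%N]mulnA.
move: (\sum_b _)%N (q * (q ^ j * _))%N (q * (q * _))%N X_gt0 Y_gt0 => S X Y.
lia.
Qed.
End CharacterBound.

Local Open Scope complex_scope.

Lemma expr_unbounded (R : realType) (t c : R) :
  (forall j, t ^+ j.+1 <= c) -> t <= 1.
Proof.
move=> bound_t; rewrite leNgt; apply/negP => t_gt1.
have bernoulli n : 1 + n%:R * (t - 1) <= t ^+ n.
  elim: n => [|n IH]; first by rewrite mul0r addr0 expr0.
  rewrite exprS -natr1; apply: le_trans (ler_wpM2l _ IH); last by lra.
  have : 0 <= n%:R * (t - 1) ^+ 2 by rewrite mulr_ge0 // sqr_ge0.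
  by rewrite expr2; nra.
have e_gt0 : 0 < t - 1 by rewrite subr_gt0.
have c_ge0 : 0 <= c / (t - 1).
  rewrite divr_ge0 ?(ltW e_gt0) //; apply: le_trans (bound_t 0%N).
  by rewrite expr1; lra.
have := archi_boundP c_ge0; rewrite ltr_pdivrMr // => lt_c.
have := le_trans (bernoulli (Num.bound (c / (t - 1))).+1) (bound_t _).
by rewrite -natr1; move: lt_c; lra.
Qed.

Lemma norm_real_complex (R : realType) (x : R) : `|x%:C| = `|x|%:C.
Proof. by rewrite normc_def /= expr0n addr0 sqrtr_sqr. Qed.

Section Weil.
Variables (R : realType) (F : finFieldType) (phi : F -> R[i]) (a : F).
Hypotheses (phiP : nontrivial_character phi) (phi_norm : forall x, `|phi x| = 1).
Local Notation q := #|F|.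

Lemma characterN x : phi (- x) = Num.conj (phi x).
Proof.
have [phi0 phiD _] := phiP.
have nz_phi : phi x != 0 by rewrite -normr_gt0 phi_norm ltr01.
apply: (mulfI nz_phi); rewrite -phiD subrr phi0.
by rewrite -normCK phi_norm expr1n.
Qed.

(** Complex conjugation replaces s by - s in the sum. *)
Lemma kloosterman_sum_real : exists x : R, kloosterman_sum phi a = x%:C.
Proof.
exists (complex.Re (kloosterman_sum phi a)); rewrite RRe_real //; apply/CrealP.
rewrite /kloosterman_sum rmorph_sum /= (reindex_inj oppr_inj) /=.
apply: eq_big => [x|x nz_x]; first by rewrite oppr_eq0.
by rewrite -characterN opprD mulrN invrN !opprK.
Qed.

Theorem weil_bound (x : R) : a != 0 -> kloosterman_sum phi a = x%:C ->
  x ^+ 2 <= 4 * q%:R.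
Proof.
move=> nz_a K_x; rewrite leNgt; apply/negP => gt_x.
have q_gt0 : 0 < q%:R :> R by rewrite ltr0n; apply: ltnW (finNzRing_gt1 F).
pose s := Num.sqrt (x ^+ 2 - 4 * q%:R).
have s2 : s ^+ 2 = x ^+ 2 - 4 * q%:R by rewrite sqr_sqrtr // subr_ge0 ltW.
pose b1 := (- x + s) / 2; pose b2 := (- x - s) / 2.
have sumb : b1 + b2 = - x by rewrite /b1 /b2; field.
have prodb : b1 * b2 = q%:R.
  have -> : b1 * b2 = (x ^+ 2 - s ^+ 2) / 4 by rewrite /b1 /b2; field.
  by rewrite s2; field.
have bound j : b1 ^+ 2 ^+ j.+1 + b2 ^+ 2 ^+ j.+1 <= 6 * q%:R * q%:R ^+ j.+1.
  have := @power_sum_even_bound F _ phi a phiP phi_norm (j.+1 + j.+1) j nz_a (leqnn _).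
  rewrite (@power_sum_two_roots F _ phi a _ b1%:C b2%:C) //; first last.
  - by rewrite leqnn andbT.
  - by rewrite -(rmorph_nat (real_complex R)) -prodb [RHS]rmorphM.
  - by rewrite K_x -(rmorphN (real_complex R)) -sumb [RHS]rmorphD.
  rewrite normrN -!(rmorphXn (real_complex R)) -(rmorphD (real_complex R)) /=.
  rewrite -(rmorph_nat (real_complex R)) norm_real_complex lecR => le_norm.
  rewrite -!exprM mul2n -addnn -natrX -!natrM.
  exact: le_trans (ler_norm _) le_norm.
have root_le (b c : R) : (forall j, b ^+ 2 ^+ j.+1 + c ^+ 2 ^+ j.+1
    <= 6 * q%:R * q%:R ^+ j.+1) -> b ^+ 2 <= q%:R.
  move=> bound_bc; rewrite -[leRHS]mul1r -ler_pdivrMr //.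
  apply: (@expr_unbounded R _ (6 * q%:R)) => j.
  rewrite expr_div_n ler_pdivrMr ?exprn_gt0 //; apply: le_trans (bound_bc j).
  by rewrite lerDl exprn_ge0 // sqr_ge0.
have b1q := root_le _ _ bound.
have b2q : b2 ^+ 2 <= q%:R by apply: (root_le _ b1) => j; rewrite addrC.
have x2 : x ^+ 2 = b1 ^+ 2 + b2 ^+ 2 + 2 * (b1 * b2) by rewrite -[x]opprK -sumb; ring.
by move: gt_x; rewrite x2 prodb; lra.
Qed.
End Weil.

(** * The canonical additive character *)
Section AddChar.
Variables (R : realType) (p : nat) (F : finFieldType) (charF : p \in [pchar F]).

Lemma expiD (s t : R) : expi (s + t) = expi s * expi t.
Proof. by rewrite /expi cosD sinD; simpc; rewrite [X in _ +i* X]addrC. Qed.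

Lemma expi0 : expi (0 : R) = 1.
Proof. by rewrite /expi cos0 sin0. Qed.

Lemma norm_expi (t : R) : `|expi t| = 1.
Proof. by rewrite normc_def /= cos2Dsin2 sqrtr1. Qed.

Let p_pr : prime p := pcharf_prime charF.
Let e (n : nat) : R[i] := expi (2 * pi * n%:R / p%:R).

Let p_neq0 : p%:R != 0 :> R.
Proof. by rewrite pnatr_eq0 -lt0n prime_gt0. Qed.

Let eD m n : e (m + n) = e m * e n.
Proof. by rewrite /e -expiD natrD mulrDr mulrDl. Qed.

Let e_mod n : e (n %% p) = e n.
Proof.
rewrite [in RHS](divn_eq n p) eD.
suff -> : e (n %/ p * p) = 1 by rewrite mul1r.
elim: (n %/ p)%N => [|k IH]; first by rewrite mul0n /e mulr0 mul0r expi0.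
rewrite mulSn eD IH mulr1 /e mulfK //.
by rewrite /expi mulrC mulr_natr cos2pi sin2pi.
Qed.

Lemma absTraceD (x y : F) : absTrace charF (x + y) = absTrace charF x + absTrace charF y.
Proof. by rewrite /absTrace !raddfD. Qed.

(** Distinct automorphisms are linearly independent, so their sum is not zero. *)
Lemma exists_absTrace_neq0 : exists x : F, absTrace charF x != 0.
Proof.
pose L := pPrimeCharType charF.
have [x _] := @gal_independent_contra _ L {:L} (fun g => g \in galoisG {:L} 1%AS)
  (fun=> 1) 1%g (group1 _) (oner_neq0 _).
under eq_bigr do rewrite mul1r.
rewrite -/(galTrace 1%AS {:L} x) => nz_tr; exists x.
by apply: contraNneq nz_tr => tr0; rewrite -absTraceE tr0.
Qed.

(** If the trace of x is m with 0 < m < p, then the value at x is the exponential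
    of i times 2 pi m / p, which is not 1 since sin (pi m / p) > 0. *)
Lemma addChar_character : nontrivial_character (addChar R charF).
Proof.
split.
- rewrite /addChar (_ : absTrace charF 0 = 0); first by rewrite mulr0 mul0r expi0.
  by apply: (addrI (absTrace charF 0)); rewrite -absTraceD !addr0.
- move=> x y; rewrite /addChar -!/(e _) -eD -[RHS]e_mod absTraceD; congr e.
  by rewrite /=; congr (_ %% _)%N; exact: Fp_cast.
have [x nz_x] := exists_absTrace_neq0; exists x.
rewrite /addChar; have : (absTrace charF x < p)%N.
  by rewrite -[X in (_ < X)%N](Fp_cast p_pr).
have : (0 < absTrace charF x)%N by rewrite lt0n.
move: (absTrace charF x : nat) => m m_gt0 lt_mp.
apply/eqP => -[cos1 _]; move: cos1.
have -> : 2 * pi * m%:R / p%:R = (pi * m%:R / p%:R) *+ 2 :> R.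
  by rewrite -[RHS]mulr_natl !mulrA.
have p_gt0' : (0 < p)%N := prime_gt0 p_pr.
have p_gt0 : 0 < p%:R :> R by rewrite ltr0n.
have : 0 < sin (pi * m%:R / p%:R : R).
  apply: sin_gt0_pi; rewrite divr_gt0 ?mulr_gt0 ?pi_gt0 ?ltr0n //=.
  by rewrite ltr_pdivrMr // ltr_pM2l ?pi_gt0 // ltr_nat.
rewrite cos_mulr2n => sin_gt0 /eqP.
rewrite subr_eq -[1 + 1]/(1 *+ 2) eqrMn2r //= => /eqP cos2.
have := cos2Dsin2 (pi * m%:R / p%:R : R); rewrite cos2 => /eqP.
by rewrite addrC -subr_eq0 addrK expf_eq0 /= gt_eqF.
Qed.

Lemma addChar_norm x : `|addChar R charF x| = 1.
Proof. exact: norm_expi. Qed.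
End AddChar.

(** * The bound for matrix Kloosterman sums *)
Lemma rmorph_scalar_recursion (A B : nzRingType) (f : {rmorphism A -> B}) q (k c : A) n :
  f (scalar_recursion q k c n) = scalar_recursion q (f k) (f c) n.
Proof.
elim/ltn_ind: n => -[|[|n]] IH; [exact: rmorph1 | by [] |].
by rewrite !scalar_recursionSS rmorphD !rmorphM !rmorph_nat !IH.
Qed.

Section ScalarSumSize.
Variables (F : finFieldType) (C : numFieldType) (phi : F -> C) (al : F).
Hypotheses (phiP : nontrivial_character phi) (phi_norm : forall x, `|phi x| = 1).

Lemma kloosterman_sum_trivial_bound : `|kloosterman_sum phi al| <= #|F|%:R - 1.
Proof.
apply: (le_trans (ler_norm_sum _ _ _)); under eq_bigr do rewrite phi_norm.
rewrite sumr_const (_ : #|_| = #|predC1 (0 : F)|); last exact: eq_card.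
by rewrite cardC1 -subn1 natrB ?lexx // ltnW // finNzRing_gt1.
Qed.

Lemma kloosterman_sum_at0 : kloosterman_sum phi 0 = -1.
Proof.
have [phi0 _ _] := phiP; apply/eqP; rewrite -addr_eq0 -phi0 addrC.
rewrite /kloosterman_sum (reindex_inj invr_inj) /=.
rewrite (eq_big (fun x => x != 0) phi) => [|x|x _].
- by apply/eqP; rewrite -[RHS](sum_character phiP) [RHS](bigD1 0).
- by rewrite invr_eq0.
by rewrite mul0r add0r invrK.
Qed.
End ScalarSumSize.

Lemma powR_three_quarters (R : realType) (q n : nat) : (0 < q)%N ->
  (q%:R : R) `^ ((3 * n%:R ^+ 2 - (odd n)%:R) / 4) =
  if odd n then q%:R ^+ (3 * n./2 * n./2 + 3 * n./2) * Num.sqrt q%:R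
  else q%:R ^+ (3 * n./2 * n./2).
Proof.
move=> q_gt0; set j := n./2; have q_ge0 : 0 <= q%:R :> R by rewrite ler0n.
have := odd_double_half n; rewrite -/j -muln2; case: (odd n) => <- /=.
  have -> : (3 * (true + j * 2)%:R ^+ 2 - true%:R) / 4 =
      (3 * j * j + 3 * j)%:R + 2^-1 :> R.
    by rewrite -[nat_of_bool true]/1%N !natrD !natrM; field.
  rewrite powRD ?powR_mulrn ?powR12_sqrt //.
  by rewrite pnatr_eq0 -lt0n q_gt0 implybT.
rewrite -[RHS]powR_mulrn //; congr (_ `^ _).
by rewrite add0n !natrM; field.
Qed.

Theorem theorem1p6 (R : realType) (p : nat) (F : finFieldType)
    (charF : p \in [pchar F]) (n : nat) (a : 'M[F]_n) (alpha : F)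
    (a_eigen : char_poly a = ('X - alpha%:P) ^+ n) :
  `|Kloosterman R charF a| <= `|Kloosterman R charF (alpha%:M : 'M[F]_n)| /\
  `|Kloosterman R charF (alpha%:M : 'M[F]_n)|
    <= (4 * #|F|%:R `^ ((3 * n%:R ^+ 2 - (odd n)%:R) / 4))%:C.
Proof.
have phiP := addChar_character R charF; have phi_norm := addChar_norm R charF.
pose K m (b : 'M[F]_m) := matrix_kloosterman (addChar R charF) b.
rewrite -[Kloosterman _ _ a]/(K n a) -[Kloosterman _ _ _]/(K n alpha%:M).
have [x K1x] := kloosterman_sum_real alpha phiP phi_norm.
pose s : R := if 0 <= x then 1 else -1.
have ss : s * s = 1 by rewrite /s; case: ifP => _; rewrite ?mulrNN mulr1.
have xE : x = s * `|x|.
  rewrite /s; case: (leP 0 x) => [x_ge0|x_lt0]; first by rewrite ger0_norm ?mul1r.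
  by rewrite ltr0_norm ?mulN1r ?opprK.
have normK : `|K n alpha%:M| = (scalar_recursion #|F| `|x| (alpha != 0)%:R n)%:C.
  rewrite /K (norm_matrix_kloosterman_scalar phiP n (s := s%:C)).
  - rewrite K1x norm_real_complex.
    rewrite -[RHS]/(real_complex R _) rmorph_scalar_recursion /=.
    by rewrite rmorph_nat.
  - by rewrite -(rmorphM (real_complex R)) ss.
  by rewrite K1x norm_real_complex -[RHS](rmorphM (real_complex R)) -xE.
split.
  rewrite normK; have := matrix_kloosterman_le phiP phi_norm a_eigen.
  rewrite K1x norm_real_complex => /le_trans; apply.
  by rewrite -[leRHS]/(real_complex R _) rmorph_scalar_recursion /= rmorph_nat.
rewrite normK lecR powR_three_quarters; last by apply: ltnW; apply: finNzRing_gt1.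
have q_gt1 := finNzRing_gt1 F.
have k_triv : `|x| <= #|F|%:R - 1.
  have := kloosterman_sum_trivial_bound alpha phi_norm; rewrite K1x norm_real_complex.
  by rewrite -(rmorph_nat (real_complex R)) -(rmorph1 (real_complex R)) -rmorphB lecR.
have k_weil : `|x| ^+ 2 <= 4 * #|F|%:R.
  rewrite real_normK ?num_real //; have [al0|nz_al] := eqVneq alpha 0; last first.
    exact: (weil_bound phiP phi_norm nz_al K1x).
  have x1 : x = -1.
    apply: (@complexI R); rewrite -K1x al0 kloosterman_sum_at0 //.
    by rewrite rmorphN rmorph1.
  rewrite x1 sqrrN expr1n -natrM ler1n muln_gt0 /=; exact: ltnW.
have c_le1 : (alpha != 0)%:R <= 1 :> R by rewrite lern1; case: (alpha != 0).
have [even_n odd_n] :=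
  scalar_recursion_parity q_gt1 (normr_ge0 x) (ler0n _ _) c_le1 k_triv k_weil n./2.
have := odd_double_half n; rewrite -mul2n; case: (odd n) => def_n.
  by rewrite -{1}def_n add1n.
by rewrite -{1}def_n add0n.
Qed.
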